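(* Let $H$ be a Hilbert space and let $Q\in\mathbb{B}(H)$ be a non-projection idempotent, with associated spaces $H_1,H_4,H_5$, unitary $V_Q:H\to H_1\oplus H_4\oplus H_5\oplus H_5$ and operator $D\in\mathbb{B}(H_5)$ as in the canonical decomposition of $Q$ described in the context. If $1\notin\sigma(D)$, then $$C^*\{Q\}=\Big\{V_Q^*\big(\alpha I_{H_1}\oplus 0_{H_4}\oplus T\big)V_Q:\ \alpha\in\mathbb{C},\ T\in M_2\big(C^*\{D\}\big)\Big\}.$$
   Context: $H$ is a non-zero complex Hilbert space and $\mathbb{B}(H)$ the bounded operators on it. An idempotent satisfies $Q^2=Q$; a projection is a self-adjoint idempotent; a non-projection idempotent is an idempotent that is not a projection. $\mathcal{R},\mathcal{N}$ denote range and null space, $P_M$ the orthogonal projection onto a closed subspace $M$, $\sigma(\cdot)$ the spectrum, $|T|=(T^*T)^{1/2}$, $T^\dag$ the Moore-Penrose inverse. $C^*\{T\}$ is the $C^*$-algebra generated by $T$ alone (not assumed to contain the identity), and $M_2(\mathfrak{B})$ is the algebra of $2\times2$ matrices over $\mathfrak{B}$. Matched projection: $m(Q)=\frac12(|Q^*|+Q^* )|Q^*|^\dag(|Q^*|+I)^{-1}(|Q^*|+Q)$, which is a projection. Canonical decomposition of a non-projection idempotent $Q$: put $H_1=\mathcal{R}(m(Q))\cap\mathcal{R}(Q)$, $H_4=\mathcal{N}(m(Q))\cap\mathcal{N}(Q)$, $H_5=\overline{\mathcal{R}(m(Q)Q(I-m(Q)))}$, $H_6=\overline{\mathcal{R}((I-m(Q))Qm(Q))}$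 (some of $H_1,H_4$ may be zero). These are mutually orthogonal with $m(Q)=P_{H_1}+P_{H_5}$ and $I-m(Q)=P_{H_4}+P_{H_6}$, and $U_{m(Q),Q}:H\to H_1\oplus H_4\oplus H_5\oplus H_6$, $x\mapsto(P_{H_1}x,P_{H_4}x,P_{H_5}x,P_{H_6}x)^T$, is unitary. It is known that there are a unitary $U\in\mathbb{B}(H_5,H_6)$ and an operator $D\in\mathbb{B}(H_5)$ with $D\ge I_{H_5}$ and $\mathcal{N}(D-I_{H_5})=\{0\}$ such that, with $\ell(D)=(D(D-I_{H_5}))^{1/2}$, $$U_{m(Q),Q}\,Q\,U_{m(Q),Q}^*=I_{H_1}\oplus 0_{H_4}\oplus\begin{pmatrix}D&-\ell(D)U^*\\ U\ell(D)&U(I_{H_5}-D)U^*\end{pmatrix}.$$ Set $V_Q=(I_{H_1}\oplus I_{H_4}\oplus I_{H_5}\oplus U^* )U_{m(Q),Q}$. Then $$m(Q)=V_Q^*\big(I_{H_1}\oplus0_{H_4}\oplus I_{H_5}\oplus0_{H_5}\big)V_Q,\qquad Q=V_Q^*\big(I_{H_1}\oplus0_{H_4}\oplus\widetilde{Q}\big)V_Q,\qquad \widetilde{Q}=\begin{pmatrix}D&-\ell(D)\\ \ell(D)&I_{H_5}-D\end{pmatrix}.$$ *)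

(* Defs.v *)
From HB Require Import structures.
From mathcomp Require Import all_boot all_order all_algebra.
From mathcomp Require Import sesquilinear complex ring.
From mathcomp Require Import mathcomp_extra boolp classical_sets functions reals.
From mathcomp Require Import topology normedtype.

Set Implicit Arguments.
Unset Strict Implicit.
Unset Printing Implicit Defensive.

Import Order.TTheory GRing.Theory Num.Theory.
Import numFieldNormedType.Exports.

Local Open Scope classical_set_scope.
Local Open Scope ring_scope.

HB.mixin Record isHilbert (R : realType) V of CompleteNormedModule R[i] V := {
  hdot : {dot V for Num.conj} ;
  sqr_hnorm : forall x : V, `|x| ^+ 2 = hdot x x
}.

#[short(type="hilbertType")]
HB.structure Definition Hilbert (R : realType) :=
  {V of CompleteNormedModule R[i] V & isHilbert R V}.

Section DotNorm.
Variables (C : numClosedFieldType) (V : lmodType C) (f : {dot V for Num.conj}).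

Definition dotnorm (x : V) : C := sqrtC (f x x).

Lemma dot_ge0 x : 0 <= f x x.
Proof.
have [->|x0] := eqVneq x 0; first by rewrite linear0r.
exact/ltW/neq0_dnorm_gt0.
Qed.

Lemma dotC x y : f x y = (f y x)^*.
Proof. by rewrite hermitian_subproof expr0 mul1r. Qed.

Lemma dotnorm_ge0 x : 0 <= dotnorm x.
Proof. by rewrite sqrtC_ge0 dot_ge0. Qed.

Lemma sqr_dotnorm x : dotnorm x ^+ 2 = f x x.
Proof. exact: sqrtCK. Qed.

Lemma dot_cauchy_schwarz x y : `|f x y| ^+ 2 <= f x x * f y y.
Proof.
have [->|y0] := eqVneq y 0; first by rewrite !linear0r normr0 expr0n mulr0.
have yy0 : 0 < f y y by exact: neq0_dnorm_gt0.
have := dot_ge0 (f y y *: x - f x y *: y).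
rewrite linearBl linearBr /= linearBr /= !linearZl_LR !linearZr_LR /=.
rewrite (geC0_conj (ltW yy0)) -dotC => h.
have {}h : 0 <= f y y * (f x x * f y y - `|f x y| ^+ 2).
  by move: h; rewrite normCK [f y x]dotC; congr (_ <= _); ring.
by move: h; rewrite pmulr_rge0 // subr_ge0.
Qed.

Lemma dotnormD x y : dotnorm (x + y) <= dotnorm x + dotnorm y.
Proof.
rewrite -ler_sqr ?nnegrE ?addr_ge0 ?dotnorm_ge0 // sqrrD !sqr_dotnorm.
rewrite linearDl !linearDr /= -!addrA lerD2l !addrA lerD2r.
have /le_trans -> // : f x y + f y x <= `|f x y| *+ 2.
  have -> : f x y + f y x = 'Re (f x y) *+ 2.
    by rewrite ReE -dotC -mulr_natr divfK // pnatr_eq0.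
  by rewrite lerMn2r /=; exact: leif_Re_Creal.
rewrite lerMn2r /=.
rewrite -ler_sqr ?nnegrE ?mulr_ge0 ?dotnorm_ge0 // exprMn !sqr_dotnorm.
exact: dot_cauchy_schwarz.
Qed.

Lemma dotnormZ a x : dotnorm (a *: x) = `|a| * dotnorm x.
Proof.
rewrite /dotnorm linearZl_LR linearZr_LR /= mulrA -normCK.
by rewrite sqrtCM ?nnegrE ?exprn_ge0 ?dot_ge0 // sqrCK.
Qed.

Lemma dotnorm0_eq0 x : dotnorm x = 0 -> x = 0.
Proof.
move/eqP; rewrite sqrtC_eq0 => h; apply/eqP/negPn/negP => x0.
by have := neq0_dnorm_gt0 (s := f) x x0; rewrite (eqP h) ltxx.
Qed.

End DotNorm.

Lemma cauchy_contract (K : numFieldType) (V W : normedModType K) (f : V -> W)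
    (F : set_system V) : ProperFilter F ->
  (forall x y, `|f x - f y| <= `|x - y|) -> cauchy F -> cauchy (f @ F).
Proof.
move=> FF fc /cauchyP Fc; apply/cauchyP => e e0.
have [x Fx] := Fc _ e0; exists (f x).
apply: (@filterS _ F _ _ _ _ Fx) => y; rewrite /= -!ball_normE /= => xy.
exact: le_lt_trans (fc x y) xy.
Qed.

Record closedSubspace (R : realType) (H : hilbertType R) := ClosedSubspace {
  subspace_set : set H ;
  subspace0 : subspace_set 0 ;
  subspace_linear : forall (a : R[i]) (x y : H),
    subspace_set x -> subspace_set y -> subspace_set (a *: x + y) ;
  subspace_closed : closed subspace_set
}.

Section ClosedSubspaceHilbert.
Variables (R : realType) (H : hilbertType R) (M : closedSubspace H).

Definition subspace_pred : pred H := fun x => x \in subspace_set M.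

Lemma subspace_submod : submod_closed subspace_pred.
Proof.
split; first by rewrite unfold_in; apply/mem_set/subspace0.
move=> a x y /set_mem Mx /set_mem My; apply/mem_set.
exact: subspace_linear.
Qed.

HB.instance Definition _ :=
  GRing.isSubmodClosed.Build R[i] H subspace_pred subspace_submod.

Definition subspace_type : Type := {x : H | subspace_pred x}.

HB.instance Definition _ := [isSub of subspace_type for @sval H subspace_pred].
HB.instance Definition _ := [Choice of subspace_type by <:].
HB.instance Definition _ := [SubChoice_isSubLmodule of subspace_type by <:].

Definition subspace_dot (x y : subspace_type) : R[i] := hdot (val x) (val y).

Let subspace_dotBl u' : zmod_morphism (subspace_dot ^~ u').
Proof. by move=> x y; rewrite /subspace_dot raddfB linearBl. Qed.
Let subspace_dotBr u : zmod_morphism (subspace_dot u).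
Proof. by move=> x y; rewrite /subspace_dot !raddfB. Qed.
Let subspace_dotZl u' : scalable_for *%R (subspace_dot ^~ u').
Proof. by move=> a x; rewrite /subspace_dot linearZ linearZl_LR. Qed.
Let subspace_dotZr u : scalable_for (Num.conj \; *%R) (subspace_dot u).
Proof. by move=> a x; rewrite /subspace_dot !linearZ. Qed.

HB.instance Definition _ := isBilinear.Build R[i] subspace_type subspace_type
  R[i] *%R (Num.conj \; *%R) subspace_dot
  subspace_dotBl subspace_dotBr subspace_dotZl subspace_dotZr.

Let subspace_dotC (x y : subspace_type) :
  subspace_dot x y = (-1) ^+ false * (subspace_dot y x)^*.
Proof. by rewrite expr0 mul1r -dotC. Qed.

HB.instance Definition _ := isHermitianSesquilinear.Build R[i] subspace_type
  false Num.conj subspace_dot subspace_dotC.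

Let subspace_dot_gt0 (x : subspace_type) : x != 0 -> 0 < subspace_dot x x.
Proof.
move=> x0; apply: neq0_dnorm_gt0; apply: contraNN x0 => /eqP x0.
by apply/eqP/val_inj; rewrite x0 raddf0.
Qed.

HB.instance Definition _ :=
  isDotProduct.Build R[i] subspace_type subspace_dot subspace_dot_gt0.

HB.instance Definition _ := Lmodule_isNormed.Build R[i] subspace_type
  (dotnormD subspace_dot) (dotnormZ subspace_dot) (@dotnorm0_eq0 _ _ subspace_dot).

Let subspace_sqr_norm (x : subspace_type) : `|x| ^+ 2 = subspace_dot x x.
Proof. exact: sqr_dotnorm. Qed.

Lemma subspace_normE (x : subspace_type) : `|x| = `|val x|.
Proof.
apply/eqP; rewrite -(@eqrXn2 _ 2) //.
by rewrite subspace_sqr_norm sqr_hnorm.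
Qed.

Let subspace_complete (F : set_system subspace_type) :
  ProperFilter F -> cauchy F -> cvg F.
Proof.
move=> FF Fc.
have vFc : cauchy ((val : subspace_type -> H) @ F).
  by apply: cauchy_contract => // x y; rewrite -raddfB subspace_normE.
have /cauchy_cvg/cvg_ex[l vFl] := vFc.
have Ml : l \in subspace_set M.
  apply/mem_set; have MC := @subspace_closed _ _ M.
  apply: (@closed_cvg _ _ F _ (val : subspace_type -> H) (subspace_set M) MC _ _ vFl).
  by apply: nearW => x; exact/set_mem/(valP x).
apply/cvg_ex; exists (Sub l Ml : subspace_type).
apply/cvgrPdist_lt => e e0; move/cvgrPdist_lt : vFl => /(_ e e0).
by apply: filterS => x; rewrite subspace_normE raddfB.
Qed.

HB.instance Definition _ :=
  Uniform_isComplete.Build subspace_type subspace_complete.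

HB.instance Definition _ :=
  isHilbert.Build R subspace_type subspace_sqr_norm.

End ClosedSubspaceHilbert.

Definition subspace_hilbert (R : realType) (H : hilbertType R)
  (M : closedSubspace H) : hilbertType R := subspace_type M.
Coercion subspace_hilbert : closedSubspace >-> Hilbert.type.

Section HilbertSum.
Variables (R : realType) (H K : hilbertType R).

(* An alias is needed because the library norms [H * K] by the maximum. *)
Definition hsum : Type := (H * K)%type.

HB.instance Definition _ := GRing.Lmodule.copy hsum (H * K)%type.

Definition hsum_dot (x y : hsum) : R[i] := hdot x.1 y.1 + hdot x.2 y.2.

Let hsum_dotBl u' : zmod_morphism (hsum_dot ^~ u').
Proof. by move=> x y; rewrite /hsum_dot !linearBl opprD addrACA. Qed.
Let hsum_dotBr u : zmod_morphism (hsum_dot u).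
Proof. by move=> x y; rewrite /hsum_dot !linearBr opprD addrACA. Qed.
Let hsum_dotZl u' : scalable_for *%R (hsum_dot ^~ u').
Proof. by move=> a x; rewrite /hsum_dot !linearZl_LR mulrDr. Qed.
Let hsum_dotZr u : scalable_for (Num.conj \; *%R) (hsum_dot u).
Proof. by move=> a x; rewrite /hsum_dot !linearZr_LR /= mulrDr. Qed.

HB.instance Definition _ := isBilinear.Build R[i] hsum hsum
  R[i] *%R (Num.conj \; *%R) hsum_dot
  hsum_dotBl hsum_dotBr hsum_dotZl hsum_dotZr.

Let hsum_dotC (x y : hsum) :
  hsum_dot x y = (-1) ^+ false * (hsum_dot y x)^*.
Proof. by rewrite expr0 mul1r /hsum_dot rmorphD /= -!dotC. Qed.

HB.instance Definition _ := isHermitianSesquilinear.Build R[i] hsum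
  false Num.conj hsum_dot hsum_dotC.

Let hsum_dot_gt0 (x : hsum) : x != 0 -> 0 < hsum_dot x x.
Proof.
move=> x0; rewrite lt0r addr_ge0 ?dot_ge0 // andbT.
apply: contraNN x0; rewrite /hsum_dot paddr_eq0 ?dot_ge0 //.
rewrite -!sqr_hnorm !sqrf_eq0 !normr_eq0 => /andP[/eqP x1 /eqP x2].
by apply/eqP; rewrite [x]surjective_pairing x1 x2.
Qed.

HB.instance Definition _ :=
  isDotProduct.Build R[i] hsum hsum_dot hsum_dot_gt0.

HB.instance Definition _ := Lmodule_isNormed.Build R[i] hsum
  (dotnormD hsum_dot) (dotnormZ hsum_dot) (@dotnorm0_eq0 _ _ hsum_dot).

Lemma hsum_sqr_norm (x : hsum) : `|x| ^+ 2 = hsum_dot x x.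
Proof. exact: sqr_dotnorm. Qed.

Let hsum_fst_le (x : hsum) : `|x.1| <= `|x|.
Proof.
rewrite -ler_sqr ?nnegrE // hsum_sqr_norm !sqr_hnorm.
by rewrite lerDl dot_ge0.
Qed.

Let hsum_snd_le (x : hsum) : `|x.2| <= `|x|.
Proof.
rewrite -ler_sqr ?nnegrE // hsum_sqr_norm !sqr_hnorm.
by rewrite lerDr dot_ge0.
Qed.

Let hsum_le (x : hsum) : `|x| <= `|x.1| + `|x.2|.
Proof.
rewrite -ler_sqr ?nnegrE ?addr_ge0 // hsum_sqr_norm /hsum_dot -!sqr_hnorm.
by rewrite sqrrD addrAC lerDl mulrn_wge0 // mulr_ge0.
Qed.

Let hsum_complete (F : set_system hsum) :
  ProperFilter F -> cauchy F -> cvg F.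
Proof.
move=> FF Fc.
have Fc1 : cauchy ((fst : hsum -> H) @ F).
  by apply: cauchy_contract => // x y; exact: (hsum_fst_le (x - y)).
have Fc2 : cauchy ((snd : hsum -> K) @ F).
  by apply: cauchy_contract => // x y; exact: (hsum_snd_le (x - y)).
have /cauchy_cvg/cvg_ex[l Fl] := Fc1.
have /cauchy_cvg/cvg_ex[k Fk] := Fc2.
apply/cvg_ex; exists ((l, k) : hsum).
apply/cvgrPdist_lt => e e0; have e20 : 0 < e / 2 by rewrite divr_gt0.
move/cvgrPdist_lt : Fl => /(_ _ e20) Fl; move/cvgrPdist_lt : Fk => /(_ _ e20) Fk.
near=> x; apply: (le_lt_trans (hsum_le _)); rewrite [e]splitr.
by apply: ltrD; near: x.
Unshelve. all: by end_near. Qed.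

HB.instance Definition _ := Uniform_isComplete.Build hsum hsum_complete.

HB.instance Definition _ := isHilbert.Build R hsum hsum_sqr_norm.

End HilbertSum.

(* Operators are plain functions, so that the pointwise [+] and [*:] and the
   composition [\o] apply to them; membership in B(H, K) is [bounded_op]. *)
Definition bounded_op (R : realType) (H K : hilbertType R) (T : H -> K) : Prop :=
  linear T /\ exists c : R[i], forall x, `|T x| <= c * `|x|.

(* Norms of vectors take values in R[i], hence the real part. *)
Definition opnorm (R : realType) (H K : hilbertType R) (T : H -> K) : R :=
  sup [set complex.Re `|T x| | x in [set x : H | `|x| <= 1]].

Definition nullspace (R : realType) (H K : hilbertType R) (T : H -> K) : set H :=
  [set x | T x = 0].

(* The operators below are determined uniquely by their defining property.
   [xget] selects the unique witness, and returns a dummy value if there is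
   none (which for [opsqrt], [mp_inverse], [op_inverse] does happen for
   operators outside of their usual domain of definition). *)
Definition adjoint (R : realType) (H K : hilbertType R) (T : H -> K) : K -> H :=
  xget 0 [set S : K -> H | forall x y, hdot (T x) y = hdot x (S y)].

Definition positive_op (R : realType) (H : hilbertType R) (T : H -> H) : Prop :=
  bounded_op T /\ forall x, 0 <= hdot (T x) x.

Definition opsqrt (R : realType) (H : hilbertType R) (T : H -> H) : H -> H :=
  xget 0 [set S : H -> H | positive_op S /\ S \o S = T].

Definition opabs (R : realType) (H K : hilbertType R) (T : H -> K) : H -> H :=
  opsqrt (adjoint T \o T).

Definition mp_inverse (R : realType) (H K : hilbertType R) (T : H -> K) : K -> H :=
  xget 0 [set S : K -> H |
    [/\ bounded_op S, T \o S \o T = T, S \o T \o S = S,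
        adjoint (T \o S) = T \o S & adjoint (S \o T) = S \o T]].

Definition is_op_inverse (R : realType) (H K : hilbertType R)
    (T : H -> K) (S : K -> H) : Prop :=
  [/\ bounded_op S, S \o T = idfun & T \o S = idfun].

Definition op_inverse (R : realType) (H K : hilbertType R) (T : H -> K) : K -> H :=
  xget 0 [set S | is_op_inverse T S].

Definition spectrum (R : realType) (H : hilbertType R) (T : H -> H) : set R[i] :=
  [set z | ~ exists S, is_op_inverse (T - z *: idfun) S].

Definition unitary_op (R : realType) (H K : hilbertType R) (T : H -> K) : Prop :=
  [/\ bounded_op T, adjoint T \o T = idfun & T \o adjoint T = idfun].

Definition is_idempotent (R : realType) (H : hilbertType R) (Q : H -> H) : Prop :=
  bounded_op Q /\ Q \o Q = Q.

Definition is_projection (R : realType) (H : hilbertType R) (Q : H -> H) : Prop :=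
  is_idempotent Q /\ adjoint Q = Q.

(* The orthogonal projection onto [M], as a map into [M]. *)
Definition orthproj (R : realType) (H : hilbertType R) (M : closedSubspace H)
    (x : H) : M :=
  xget (0 : M) [set y : M | forall z : M, hdot (x - sval y) (sval z) = 0].

Record Cstar_subalgebra (R : realType) (H : hilbertType R) (A : set (H -> H)) :
    Prop := {
  Cstar_bounded : forall T, A T -> bounded_op T ;
  Cstar_zero : A 0 ;
  Cstar_add : forall S T, A S -> A T -> A (S + T) ;
  Cstar_scale : forall (a : R[i]) T, A T -> A (a *: T) ;
  Cstar_comp : forall S T, A S -> A T -> A (S \o T) ;
  Cstar_adjoint : forall T, A T -> A (adjoint T) ;
  Cstar_closed : forall T, bounded_op T ->
    (forall e : R, 0 < e -> exists2 S, A S & opnorm (T - S) < e) -> A T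
}.

(* No unit is required: this is the possibly non-unital C*-algebra. *)
Definition Cstar_gen (R : realType) (H : hilbertType R) (T : H -> H) :
    set (H -> H) :=
  smallest (@Cstar_subalgebra R H) [set T].

Definition op_diag (R : realType) (H1 H2 K1 K2 : hilbertType R)
    (S : H1 -> K1) (T : H2 -> K2) : hsum H1 H2 -> hsum K1 K2 :=
  fun x => (S x.1, T x.2).

Definition op_block (R : realType) (H1 H2 K1 K2 : hilbertType R)
    (T11 : H1 -> K1) (T12 : H2 -> K1) (T21 : H1 -> K2) (T22 : H2 -> K2) :
    hsum H1 H2 -> hsum K1 K2 :=
  fun x => (T11 x.1 + T12 x.2, T21 x.1 + T22 x.2).

Definition matrix2 (R : realType) (H : hilbertType R) (B : set (H -> H)) :
    set (hsum H H -> hsum H H) :=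
  [set T | exists a b c d, [/\ B a, B b, B c & B d] /\ T = op_block a b c d].

Definition matched_projection (R : realType) (H : hilbertType R) (Q : H -> H) :
    H -> H :=
  let Qs := adjoint Q in
  let A := opabs Qs in
  (2^-1 : R[i]) *:
    ((A + Qs) \o mp_inverse A \o op_inverse (A + idfun) \o (A + Q)).

(* The map x |-> (P_{H1} x, P_{H4} x, P_{H5} x, P_{H6} x); the fourfold direct
   sum is bracketed as (H1 + H4) + (H5 + H6). *)
Definition canonical_map (R : realType) (H : hilbertType R)
    (H1 H4 H5 H6 : closedSubspace H) :
    H -> hsum (hsum H1 H4) (hsum H5 H6) :=
  fun x => ((orthproj H1 x, orthproj H4 x), (orthproj H5 x, orthproj H6 x)).

Definition ell (R : realType) (H : hilbertType R) (D : H -> H) : H -> H :=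
  opsqrt (D \o (D - idfun)).

Record canonical_decomposition (R : realType) (H : hilbertType R) (Q : H -> H)
    (H1 H4 H5 H6 : closedSubspace H) (U : H5 -> H6) (D : H5 -> H5) : Prop := {
  canonical_H1 : subspace_set H1 = range (matched_projection Q) `&` range Q ;
  canonical_H4 :
    subspace_set H4 = nullspace (matched_projection Q) `&` nullspace Q ;
  canonical_H5 : subspace_set H5 = closure (range
    (matched_projection Q \o Q \o (idfun - matched_projection Q))) ;
  canonical_H6 : subspace_set H6 = closure (range
    ((idfun - matched_projection Q) \o Q \o matched_projection Q)) ;
  canonical_U : unitary_op U ;
  canonical_D : bounded_op D ;
  canonical_D_ge1 : positive_op (D - idfun) ;
  canonical_D_inj : nullspace (D - idfun) = [set 0] ;
  canonical_Q :
    let W := canonical_map H1 H4 H5 H6 in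
    W \o Q \o adjoint W =
    op_diag (op_diag idfun 0)
      (op_block D (- (ell D \o adjoint U))
                (U \o ell D) (U \o (idfun - D) \o adjoint U))
}.

Definition canonical_unitary (R : realType) (H : hilbertType R)
    (H1 H4 H5 H6 : closedSubspace H) (U : H5 -> H6) :
    H -> hsum (hsum H1 H4) (hsum H5 H5) :=
  op_diag (op_diag idfun idfun) (op_diag idfun (adjoint U)) \o
  canonical_map H1 H4 H5 H6.

(* Main.v *)
(* In the coordinates given by [V], [Q] is [1 + 0 + Qt] with
   [Qt = [[D, -l], [l, 1 - D]]], [l = ell D]. That [V] is unitary follows from the
   matched projection [m]: with [J = 2 m - 1] one has [Q J = |Q^*|] and
   [|Q^*| J = Q], so [J] is a symmetry, [Q^* = J Q J] and [J Q >= 0].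

   If [1] is not in the spectrum of [D], then [D - 1], hence [D], [l ^ 2] and
   [2 D - 1], are bounded below by positive constants, and a C*-algebra containing
   such an operator contains the identity and its inverse. So [C*(D)] is unital,
   the right-hand side is a C*-algebra containing [Q], which is one inclusion.

   For the other one let [B] consist of the [Y] with [0 + Y] in [C*(Q)]. It
   contains [N = Qt - Qt^* = [[0, -2 l], [2 l, 0]]], and [- N ^ 2] is bounded
   below, so [B] is unital, [Qt] is in [B] and [1 + 0 + 0] is in [C*(Q)]. Then [B]
   contains [S = Qt + Qt^* - 1 = diag (2 D - 1, 1 - 2 D)] and the square root
   [diag (2 D - 1, 2 D - 1)] of [S ^ 2], hence [diag (1, 0)], hence all
   [diag (T, 0)] with [T] in [C*(D)], and, dividing the off-diagonal corner of
   [Qt] by [l], the matrix units. *)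
Require Import Defs.
From HB Require Import structures.
From mathcomp Require Import all_boot all_order all_algebra.
From mathcomp Require Import sesquilinear complex ring lra.
From mathcomp Require Import mathcomp_extra boolp classical_sets functions reals.
From mathcomp Require Import topology normedtype.

Set Implicit Arguments.
Unset Strict Implicit.
Unset Printing Implicit Defensive.

Import Order.TTheory GRing.Theory Num.Theory.
Import numFieldNormedType.Exports.

Local Open Scope classical_set_scope.
Local Open Scope ring_scope.

(** * Real-valued norm and inner product *)

(** The operators in the statement are picked by [xget], so each one has to be constructed before
    its defining property can be used. Functional calculus is avoided: only inverses of operators
    bounded below and positive square roots are constructed, both as norm limits of polynomials. In
    an algebra not known to have a unit, only polynomials without constant term are available, and
    this shapes both iterations.

    The decomposition record does not state that [H1], [H4], [H5], [H6] are orthogonal or span [H];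
    both facts are derived from the formula for the matched projection.

    The obstacle in the second inclusion is to separate the scalar on [H1] from the matrix on the
    other summand. In the new coordinates Q and its adjoint agree on the first summand, so their
    difference lives on the second one alone. The hypothesis on the spectrum makes it invertible
    there, which yields the projection onto that summand. *)

Section Basics.
Variables (R : realType) (H : hilbertType R).
Implicit Types (x y z : H) (a : R[i]) (r : R).

(* The real values of the norm and inner product of [H], where [lra] and [nra]
   apply; [cdot] is a rewritable copy of [hdot]. *)
Definition hnorm x : R := complex.Re `|x|.
Definition cdot x y : R[i] := hdot x y.
Definition rdot x y : R := complex.Re (cdot x y).

Lemma norm_hnorm x : `|x| = (hnorm x)%:C%C.
Proof. by rewrite /hnorm RRe_real // ger0_real. Qed.

Lemma hnorm_ge0 x : 0 <= hnorm x.
Proof. by rewrite -ler0c -norm_hnorm. Qed.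

Lemma cdot_self x : cdot x x = (hnorm x ^+ 2)%:C%C.
Proof. by rewrite /cdot -sqr_hnorm norm_hnorm rmorphXn. Qed.

Lemma sqr_hnorm x : hnorm x ^+ 2 = rdot x x.
Proof. by rewrite /rdot cdot_self. Qed.

Lemma hnorm_eq0 x : hnorm x = 0 -> x = 0.
Proof. by move=> h; apply: normr0_eq0; rewrite norm_hnorm h. Qed.

Lemma hnorm0 : hnorm (0 : H) = 0.
Proof. by rewrite /hnorm normr0. Qed.

Lemma hnormD x y : hnorm (x + y) <= hnorm x + hnorm y.
Proof. by rewrite -lecR rmorphD /= -!norm_hnorm ler_normD. Qed.

Lemma hnormN x : hnorm (- x) = hnorm x.
Proof. by rewrite /hnorm normrN. Qed.

Lemma hnormB x y : hnorm (x - y) <= hnorm x + hnorm y.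
Proof. by rewrite -(hnormN y) hnormD. Qed.

Lemma hnormZ a x : hnorm (a *: x) = complex.Re `|a| * hnorm x.
Proof.
rewrite /hnorm normrZ (norm_hnorm x).
by case: `|a| => u v /=; rewrite mulr0 subr0.
Qed.

Lemma hnormZr r x : hnorm (r%:C%C *: x) = `|r| * hnorm x.
Proof. by rewrite hnormZ normc_def /= expr0n /= addr0 sqrtr_sqr. Qed.

Lemma cdotC x y : cdot x y = (cdot y x)^*%C.
Proof. exact: dotC. Qed.

Lemma cdotDl x y z : cdot (x + y) z = cdot x z + cdot y z.
Proof. exact: linearDl. Qed.

Lemma cdotNl x y : cdot (- x) y = - cdot x y.
Proof. exact: linearNl. Qed.

Lemma cdotBl x y z : cdot (x - y) z = cdot x z - cdot y z.
Proof. exact: linearBl. Qed.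

Lemma cdotZl a x y : cdot (a *: x) y = a * cdot x y.
Proof. exact: linearZl_LR. Qed.

Lemma cdot0l x : cdot 0 x = 0.
Proof. exact: linear0l. Qed.

Lemma cdotDr x y z : cdot x (y + z) = cdot x y + cdot x z.
Proof. exact: linearDr. Qed.

Lemma cdotNr x y : cdot x (- y) = - cdot x y.
Proof. exact: linearNr. Qed.

Lemma cdotBr x y z : cdot x (y - z) = cdot x y - cdot x z.
Proof. exact: linearBr. Qed.

Lemma cdotZr a x y : cdot x (a *: y) = a^*%C * cdot x y.
Proof. exact: linearZr_LR. Qed.

Lemma cdot0r x : cdot x 0 = 0.
Proof. exact: linear0r. Qed.

Lemma rdotC x y : rdot x y = rdot y x.
Proof. by rewrite /rdot cdotC; case: (cdot y x). Qed.

Lemma rdotDl x y z : rdot (x + y) z = rdot x z + rdot y z.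
Proof. by rewrite /rdot cdotDl raddfD. Qed.

Lemma rdotDr x y z : rdot x (y + z) = rdot x y + rdot x z.
Proof. by rewrite rdotC rdotDl !(rdotC x). Qed.

Lemma rdotNl x y : rdot (- x) y = - rdot x y.
Proof. by rewrite /rdot cdotNl raddfN. Qed.

Lemma rdotNr x y : rdot x (- y) = - rdot x y.
Proof. by rewrite rdotC rdotNl rdotC. Qed.

Lemma rdotBl x y z : rdot (x - y) z = rdot x z - rdot y z.
Proof. by rewrite rdotDl rdotNl. Qed.

Lemma rdotZl r x y : rdot (r%:C%C *: x) y = r * rdot x y.
Proof.
rewrite /rdot cdotZl.
by case: (cdot x y) => u v /=; rewrite mul0r subr0.
Qed.

Lemma rdotZr r x y : rdot x (r%:C%C *: y) = r * rdot x y.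
Proof. by rewrite rdotC rdotZl rdotC. Qed.

Lemma rdot0l x : rdot 0 x = 0.
Proof. by rewrite /rdot cdot0l. Qed.

Lemma rdot0r x : rdot x 0 = 0.
Proof. by rewrite rdotC rdot0l. Qed.

Definition rdotE := (rdotDl, rdotDr, rdotNl, rdotNr, rdotZl, rdotZr).

Lemma cdotE x y : cdot x y = Complex (rdot x y) (- rdot ('i%C *: x) y).
Proof.
rewrite /rdot cdotZl.
by case: (cdot x y) => u v /=; rewrite mul0r mul1r sub0r opprK.
Qed.

Lemma cdot_eq0 x : (forall z, cdot x z = 0) -> x = 0.
Proof. by move=> h; apply: hnorm_eq0; apply/eqP; rewrite -sqrf_eq0 sqr_hnorm /rdot h. Qed.

Lemma cdot_inj x y : (forall z, cdot x z = cdot y z) -> x = y.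
Proof.
move=> h; apply/eqP; rewrite -subr_eq0; apply/eqP/cdot_eq0 => z.
by rewrite cdotBl h subrr.
Qed.

Lemma cdot_injr x y : (forall z, cdot z x = cdot z y) -> x = y.
Proof. by move=> h; apply: cdot_inj => z; rewrite cdotC h -cdotC. Qed.

(** The imaginary part of the product is, up to sign, its real part at ['i *: x]. This completes
    variational arguments, which control the real part only. *)
Lemma cdot_rdot0 (P : H -> Prop) y :
  (forall a x, P x -> P (a *: x)) -> (forall x, P x -> rdot x y = 0) ->
  forall x, P x -> cdot x y = 0.
Proof. by move=> PZ h x Px; rewrite cdotE !h ?oppr0 //; apply: PZ. Qed.

Lemma hnormD_sqr x y : hnorm (x + y) ^+ 2 = hnorm x ^+ 2 + 2 * rdot x y + hnorm y ^+ 2.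
Proof. by rewrite !sqr_hnorm !rdotE (rdotC y x); ring. Qed.

Lemma hnormB_sqr x y : hnorm (x - y) ^+ 2 = hnorm x ^+ 2 - 2 * rdot x y + hnorm y ^+ 2.
Proof. by rewrite hnormD_sqr rdotNr hnormN; ring. Qed.

End Basics.

(** For [0 < c] the minimum is at [t = - b / c]; otherwise positivity forces [c = 0] and [b = 0].
    This is the source of the Cauchy-Schwarz inequalities for [rdot] and for positive operators, and
    of the orthogonality at a nearest point. *)
Lemma quad_discr (R : realFieldType) (a b c : R) :
  (forall t, 0 <= a + 2 * t * b + t ^+ 2 * c) -> b ^+ 2 <= a * c.
Proof.
move=> h; have a0 : 0 <= a by have := h 0; rewrite !(mulr0, mul0r, expr0n) /= !addr0.
have [c0|c0|c0] := ltgtP c 0.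
(* This [t] is at least 1 and satisfies [t * c = c - (2 * |b| + a)], so [t ^+ 2 * c] outweighs
   [a + 2 * t * b]. *)
- exfalso; have := h (1 + (2 * `|b| + a) / - c).
  set s := (2 * `|b| + a) / - c.
  have s0 : 0 <= s by rewrite divr_ge0 // ?addr_ge0 ?mulr_ge0 ?oppr_ge0 // ltW.
  have sc : s * c = - (2 * `|b| + a) by rewrite /s; field; rewrite lt_eqF.
  have := ler_norm b => hb; nra.
- have := h (- (b / c)) => hh; rewrite -subr_ge0.
  suff -> : a * c - b ^+ 2 = c * (a + 2 * - (b / c) * b + (- (b / c)) ^+ 2 * c).
    exact: mulr_ge0 (ltW c0) hh.
  by field; rewrite gt_eqF.
- rewrite c0 mulr0; have [->|b0] := eqVneq b 0; first by rewrite expr0n.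
  exfalso; have := h (- ((a + 1) / (2 * b))).
  rewrite c0 mulr0 addr0.
  suff -> : a + 2 * - ((a + 1) / (2 * b)) * b = - 1 by rewrite lerNr oppr0 lt_geF.
  by field.
Qed.

Lemma rdot_CS (R : realType) (H : hilbertType R) (x y : H) :
  rdot x y <= hnorm x * hnorm y.
Proof.
apply: (le_trans (ler_norm _)).
rewrite -ler_sqr ?nnegrE ?mulr_ge0 ?hnorm_ge0 // real_normK ?num_real // exprMn.
apply: quad_discr => t.
have := sqr_ge0 (hnorm (x + t%:C%C *: y)).
by rewrite hnormD_sqr rdotZr hnormZr exprMn real_normK ?num_real // mulrA.
Qed.

(** The Cauchy rate [e] also bounds the distance to the limit, so later proofs carry an explicit
    error sequence in place of filter convergence. *)
Lemma hcomplete (R : realType) (H : hilbertType R) (u : nat -> H) (e : nat -> R) :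
  (forall eps, 0 < eps -> exists N, forall n, (N <= n)%N -> e n <= eps) ->
  (forall m n, (n <= m)%N -> hnorm (u m - u n) <= e n) ->
  exists l, forall n, hnorm (l - u n) <= e n.
Proof.
move=> e0 ue.
have uc : cauchy (u @ \oo).
  apply/cauchyP => E E0.
  have Er : E = (complex.Re E)%:C%C by rewrite RRe_real // gtr0_real.
  have E0' : 0 < complex.Re E / 2 by rewrite divr_gt0 // -ltcR -Er.
  have [N hN] := e0 _ E0'; exists (u N); exists N => // n /= Nn.
  rewrite -ball_normE /= distrC norm_hnorm Er ltcR.
  apply: le_lt_trans (ue _ _ Nn) _; apply: le_lt_trans (hN _ (leqnn _)) _.
  by rewrite ltr_pdivrMr // mulr_natr mulr2n ltrDl; lra.
have [l ul] : exists l : H, u @ \oo --> l by apply/cvg_ex; exact: cauchy_cvg.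
exists l => n.
apply/ler_addgt0Pr => eps eps0.
move/cvgrPdist_lt : ul => /(_ eps%:C%C); rewrite ltcR => /(_ eps0)[N _ hN].
have := hN (maxn N n) (leq_maxl _ _); rewrite /= norm_hnorm ltcR => h1.
have := ue (maxn N n) n (leq_maxr _ _) => h2.
have -> : l - u n = (l - u (maxn N n)) + (u (maxn N n) - u n) by rewrite addrA subrK.
by apply: le_trans (hnormD _ _) _; rewrite addrC lerD // ltW.
Qed.

(** * Orthogonal projections *)

Section ClosedSets.
Variables (R : realType) (H : hilbertType R).
Implicit Types (S : set H) (l x : H).

Lemma closure_hnormP S l :
  closure S l <-> forall eps : R, 0 < eps -> exists2 y, S y & hnorm (l - y) < eps.
Proof.
split=> [cl eps eps0|h B /nbhs_ballP[E /= E0 EB]].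
  have /cl[y [Sy]] : nbhs l (ball l eps%:C%C) by apply: nbhsx_ballx; rewrite ltcR.
  by rewrite -ball_normE /= norm_hnorm ltcR => ?; exists y.
have Er : E = (complex.Re E)%:C%C by rewrite RRe_real // gtr0_real.
have [|y Sy ly] := h (complex.Re E); first by rewrite -ltcR -Er.
by exists y; split => //; apply: EB; rewrite -ball_normE /= norm_hnorm Er ltcR.
Qed.

Lemma closed_hnormP S :
  closed S <->
  forall l, (forall eps : R, 0 < eps -> exists2 y, S y & hnorm (l - y) < eps) -> S l.
Proof.
split=> h l; first by move/closure_hnormP; exact: h.
by move/closure_hnormP; exact: h.
Qed.

End ClosedSets.

Lemma harmonic_small (R : realType) (c eps : R) : 0 <= c -> 0 < eps ->
  exists N, forall n, (N <= n)%N -> c * n.+1%:R^-1 <= eps.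
Proof.
move=> c0 e0; exists (Num.bound (c / eps)) => n Nn.
rewrite ler_pdivrMr // -ler_pdivrMl // mulrC ltW //.
apply: lt_le_trans (archi_boundP _) _; first by rewrite divr_ge0 // ltW.
by rewrite ler_nat; exact: leq_trans Nn (leqnSn _).
Qed.

Lemma le_small (R : realType) (a b c : R) : 0 <= c ->
  (forall n : nat, a <= b + c * n.+1%:R^-1) -> a <= b.
Proof.
move=> c0 h; apply/ler_addgt0Pr => e e0.
have [N hN] := harmonic_small c0 e0.
by apply: le_trans (h N) _; rewrite lerD2l hN.
Qed.

Lemma half_double (R : realType) (V : lmodType R[i]) (x : V) :
  (2^-1)%:C%C *: (x + x) = x.
Proof.
have e : (2^-1)%:C%C + (2^-1)%:C%C = 1 :> R[i].
  by rewrite -raddfD /= -[RHS]/((1 : R)%:C%C); congr (_%:C%C); field.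
by rewrite scalerDr -scalerDl e scale1r.
Qed.

Lemma orthproj_set (R : realType) (H : hilbertType R) (M : closedSubspace H) x :
  exists2 y, subspace_set M y & forall z, subspace_set M z -> cdot (x - y) z = 0.
Proof.
set S := subspace_set M.
have SD y z : S y -> S z -> S (y + z).
  by move=> Sy Sz; rewrite -[y]scale1r; exact: subspace_linear.
have SZ a y : S y -> S (a *: y).
  by move=> Sy; rewrite -[_ *: _]addr0; apply: subspace_linear => //; exact: subspace0.
pose E := [set hnorm (x - y) | y in S]; pose d := inf E.
have Elb : lbound E 0 by move=> _ [y _ <-]; exact: hnorm_ge0.
have Einf : has_inf E.
  by split; [exists (hnorm (x - 0)), 0 => //; exact: subspace0 | exists 0].
have d0 : 0 <= d by apply: lb_le_inf => //; case: Einf.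
have dle y : S y -> d <= hnorm (x - y).
  by move=> Sy; apply: ge_inf; [exists 0|exists y].
pose dl n : R := n.+1%:R^-1.
have dl0 n : 0 < dl n by rewrite invr_gt0 ltr0n.
have dl1 n : dl n <= 1 by rewrite invf_le1 ?ltr0n // ler1n.
have dlle m n : (n <= m)%N -> dl m <= dl n.
  by move=> nm; rewrite lef_pV2 ?posrE ?ltr0n // ler_nat.
(* The tolerance is the square of [dl n] because the parallelogram law bounds the square of
   [hnorm (u m - u n)]. The rate below comes from 4 ((d + e^2)^2 - d^2) <= 16 (d + 1)^2 e^2 for 0 <
   e <= 1. *)
have /choice[u uP] : forall n, exists y, S y /\ hnorm (x - y) < d + dl n ^+ 2.
  move=> n; have [_ [y Sy <-] yd] := inf_adherent (exprn_gt0 2 (dl0 n)) Einf.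
  by exists y.
have uc m n : (n <= m)%N -> hnorm (u m - u n) <= 4 * (d + 1) * dl n.
  move=> nm; rewrite -ler_sqr ?nnegrE ?hnorm_ge0 //; last first.
    by rewrite !mulr_ge0 ?addr_ge0 // ltW.
  have [Sm um] := uP m; have [Sn un] := uP n.
  have := dle _ (SZ (2^-1)%:C%C _ (SD _ _ Sm Sn)) => hmid.
  have hu : hnorm (x - (2^-1)%:C%C *: (u m + u n)) =
      2^-1 * hnorm ((x - u m) + (x - u n)).
    rewrite -[2^-1 in RHS]ger0_norm ?invr_ge0 // -hnormZr; congr hnorm.
    by rewrite addrACA -opprD scalerBr half_double.
  have e1 := hnormD_sqr (x - u m) (x - u n).
  have e2 := hnormB_sqr (x - u n) (x - u m).
  have e3 : (x - u n) - (x - u m) = u m - u n by rewrite opprB addrC addrA subrK.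
  rewrite e3 in e2; rewrite hu in hmid; rewrite rdotC in e1.
  have := hnorm_ge0 (x - u m); have := hnorm_ge0 (x - u n).
  have := hnorm_ge0 (x - u m + (x - u n)).
  have := dl0 m; have := dl0 n; have := dl1 n; have := dlle _ _ nm.
  move: um un hmid e1 e2 d0.
  move: (hnorm (x - u m)) (hnorm (x - u n)) (hnorm (x - u m + (x - u n))) (hnorm (u m - u n))
    (dl m) (dl n) (rdot _ _).
  move=> A B C F em en r Ad Bd Cd e1 e2 d0 mn n1 n0 m0 C0 B0 A0.
  have A2 : A ^+ 2 <= (d + en ^+ 2) ^+ 2.
    rewrite ler_sqr ?nnegrE ?addr_ge0 ?sqr_ge0 //; apply: le_trans (ltW Ad) _.
    by rewrite lerD2l ler_sqr ?nnegrE // ltW.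
  have B2 : B ^+ 2 <= (d + en ^+ 2) ^+ 2.
    by rewrite ler_sqr ?nnegrE ?addr_ge0 ?sqr_ge0 // ltW.
  have C2 : 4 * d ^+ 2 <= C ^+ 2 by nra.
  have -> : F ^+ 2 = 2 * A ^+ 2 + 2 * B ^+ 2 - C ^+ 2 by rewrite e1 e2; ring.
  have en4 : en ^+ 4 <= en ^+ 2.
    by rewrite -[4%N]/(2 + 2)%N exprD ger_pMr ?exprn_gt0 // expr_le1 // ltW.
  have : 2 * A ^+ 2 + 2 * B ^+ 2 - C ^+ 2 <= 4 * (2 * d * en ^+ 2 + en ^+ 4).
    lra.
  move=> /le_trans; apply; have := sqr_ge0 en; rewrite exprMn; nra.
have c0 : 0 <= 4 * (d + 1) by rewrite mulr_ge0 ?addr_ge0.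
have [l lu] := hcomplete (fun e e0 => harmonic_small c0 e0) uc.
have Sl : S l.
  apply/(closed_hnormP _).1; first exact: subspace_closed.
  move=> eps eps0; have e2 : 0 < eps / 2 by rewrite divr_gt0.
  have [N hN] := harmonic_small c0 e2.
  exists (u N); first by case: (uP N).
  by apply: le_lt_trans (lu N) _; apply: le_lt_trans (hN _ (leqnn _)) _; lra.
have ld : hnorm (x - l) <= d.
  apply: (@le_small _ _ _ (1 + 4 * (d + 1))); first by rewrite addr_ge0.
  move=> n; have [_ un] := uP n.
  have -> : x - l = (x - u n) - (l - u n) by rewrite opprB addrA subrK.
  apply: le_trans (hnormB _ _) _; rewrite mulrDl addrA mul1r; apply: lerD (lu n).
  apply: le_trans (ltW un) _; rewrite lerD2l.
  by rewrite expr2 ger_pMr // dl1.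
exists l => // z Sz; rewrite cdotC.
rewrite (@cdot_rdot0 _ _ S _ SZ) ?conjc0 // => {Sz}z Sz.
apply/eqP; rewrite -sqrf_eq0 eq_le sqr_ge0 andbT.
(* Minimality along the line through [l] in direction [z] gives a nonnegative quadratic in [t]
   without constant term, so its linear coefficient vanishes. *)
suff : (- rdot z (x - l)) ^+ 2 <= 0 * hnorm z ^+ 2 by rewrite sqrrN mul0r.
apply: quad_discr => t.
have := dle _ (SD _ _ Sl (SZ t%:C%C _ Sz)).
rewrite opprD addrA -ler_sqr ?nnegrE ?hnorm_ge0 // hnormB_sqr rdotZr hnormZr exprMn.
rewrite real_normK ?num_real // rdotC.
have : hnorm (x - l) ^+ 2 <= d ^+ 2 by rewrite ler_sqr ?nnegrE ?hnorm_ge0.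
nra.
Qed.

(** * Adjoints and bounded operators *)

Section OrthProj.
Variables (R : realType) (H : hilbertType R) (M : closedSubspace H).
Implicit Types (x : H) (y : M).

Definition emb y : H := sval y.

Lemma embP y : subspace_set M (emb y).
Proof. exact: set_mem (valP y). Qed.

Lemma emb_surj x : subspace_set M x -> exists y, emb y = x.
Proof. by move=> Mx; exists (exist _ x (mem_set Mx)). Qed.

Lemma cdot_emb y y' : cdot (emb y) (emb y') = cdot y y'.
Proof. by []. Qed.

Lemma hnorm_emb y : hnorm (emb y) = hnorm y.
Proof. by rewrite /hnorm subspace_normE. Qed.

Lemma orthprojP x y : cdot (x - emb (orthproj M x)) (emb y) = 0.
Proof.
have ex : exists y0 : M, forall z : M, hdot (x - sval y0) (sval z) = 0.
  have [y0 /emb_surj[y1 <-] h] := orthproj_set M x.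
  by exists y1 => z; apply: h; exact: embP.
exact: (xgetPex (0 : M) ex).
Qed.

Lemma cdot_orthproj x y : cdot (emb (orthproj M x)) (emb y) = cdot x (emb y).
Proof. by apply/esym/eqP; rewrite -subr_eq0 -cdotBl orthprojP. Qed.

Lemma orthproj_adj x y : cdot (orthproj M x) y = cdot x (emb y).
Proof. by rewrite -cdot_emb cdot_orthproj. Qed.

Lemma orthproj_emb y : orthproj M (emb y) = y.
Proof. by apply: cdot_inj => z; rewrite orthproj_adj cdot_emb. Qed.

Lemma orthproj_linear : linear (orthproj M).
Proof.
move=> a x y; apply: cdot_inj => z.
by rewrite orthproj_adj !cdotDl !cdotZl !orthproj_adj.
Qed.

Lemma orthproj_norm x : hnorm (orthproj M x) <= hnorm x.
Proof.
set y := orthproj M x.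
have h : hnorm y ^+ 2 <= hnorm y * hnorm x.
  rewrite sqr_hnorm /rdot orthproj_adj -[complex.Re _]/(rdot x (emb y)) mulrC -(hnorm_emb y).
  exact: rdot_CS.
have [->|y0] := eqVneq (hnorm y) 0; first exact: hnorm_ge0.
by move: h; rewrite expr2 ler_pM2l // lt0r y0 hnorm_ge0.
Qed.

End OrthProj.

Lemma normc_dot_CS (R : realType) (H : hilbertType R) (x y : H) :
  complex.Re `|cdot x y| <= hnorm x * hnorm y.
Proof.
rewrite -lecR RRe_real ?ger0_real //.
have h0 : 0 <= (hnorm x * hnorm y)%:C%C by rewrite ler0c mulr_ge0 ?hnorm_ge0.
rewrite -(ler_sqr (normr_ge0 _) h0).
apply: le_trans (dot_cauchy_schwarz _ _ _) _.
by rewrite -!/(cdot _ _) !cdot_self -rmorphM /= -exprMn rmorphXn.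
Qed.

(** A pointwise bound spares the supremum in [opnorm]; [opnorm_le] and [opbound_opnorm] translate
    between the two. *)
Definition opbound (R : realType) (H K : hilbertType R) (T : H -> K) (c : R) : Prop :=
  forall x, hnorm (T x) <= c * hnorm x.

Lemma bounded_opP (R : realType) (H K : hilbertType R) (T : H -> K) :
  bounded_op T <-> linear T /\ exists2 c : R, 0 <= c & opbound T c.
Proof.
split=> -[lT [c]].
  move=> hc; split=> //; exists (complex.Re `|c|).
    by rewrite -ler0c RRe_real ?ger0_real.
  move=> x; rewrite -lecR rmorphM /= RRe_real ?ger0_real // -!norm_hnorm.
  have h0 : 0 <= c * `|x| by exact: le_trans (normr_ge0 (T x)) (hc x).
  by apply: le_trans (hc x) _; rewrite -(ger0_norm h0) normrM normr_id.
move=> c0 hc; split=> //; exists c%:C%C => x.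
by rewrite !norm_hnorm -rmorphM lecR.
Qed.

Lemma riesz (R : realType) (H : hilbertType R) (f : H -> R[i]) :
  (forall a x y, f (a *: x + y) = a * f x + f y) ->
  (exists2 c, 0 <= c & forall x, complex.Re `|f x| <= c * hnorm x) ->
  exists y, forall x, f x = cdot x y.
Proof.
move=> lf [c c0 fc].
have f0 : f 0 = 0.
  have /eqP := lf 1 0 0; rewrite scale1r addr0 mul1r.
  by rewrite -subr_eq0 opprD addNKr oppr_eq0 => /eqP.
have fB x y : f (x - y) = f x - f y.
  by rewrite addrC -scaleN1r lf mulN1r addrC.
have fZ a x : f (a *: x) = a * f x by rewrite -[_ *: _]addr0 lf f0 addr0.
have Kcl : closed [set x | f x = 0].
  apply/closed_hnormP => l hl /=.
  suff h0 : complex.Re `|f l| <= 0.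
    apply/eqP; rewrite -normr_eq0 -[ `|f l|]RRe_real ?ger0_real //.
    rewrite (_ : complex.Re _ = 0) //; apply/eqP; rewrite eq_le h0.
    by rewrite -ler0c RRe_real ?ger0_real /=.
  apply/ler_addgt0Pr => e e0; rewrite add0r.
  have c10 : 0 < c + 1 by rewrite ltr_wpDl.
  have [y fy ly] := hl _ (divr_gt0 e0 c10).
  have -> : f l = f (l - y) by rewrite fB fy subr0.
  apply: le_trans (fc _) _.
  move: ly; rewrite ltr_pdivlMr // => ly; have := hnorm_ge0 (l - y); nra.
pose M := ClosedSubspace (f0 : [set x | f x = 0] 0)
  (fun a x y (fx : f x = 0) (fy : f y = 0) => etrans (lf a x y)
    (etrans (congr2 (fun u v => a * u + v) fx fy) (etrans (addr0 _) (mulr0 a)))) Kcl.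
have [[x0 fx0]|h] := pselect (exists x0, f x0 != 0); last first.
  exists 0 => x; rewrite cdot0r; apply/eqP/negPn/negP => fx.
  by apply: h; exists x.
have [y fy oy] := orthproj_set M x0.
pose w := x0 - y; have fw : f w != 0 by rewrite fB fy subr0.
have ww : cdot w w != 0.
  apply: contraNneq fw => ww; suff -> : w = 0 by rewrite f0.
  by apply: hnorm_eq0; apply/eqP; rewrite -sqrf_eq0 sqr_hnorm /rdot ww.
(* [w] is orthogonal to the kernel of [f], and [x - (f x / f w) *: w] lies in that kernel; pairing
   the two yields this representative. *)
exists ((f w / cdot w w)^*%C *: w) => x.
have : cdot w (x - (f x / f w) *: w) = 0.
  by apply: oy; rewrite /= fB fZ divfK // subrr.
move=> /(congr1 (fun z => z^*%C)); rewrite -cdotC cdotBl cdotZl conjc0 => /eqP.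
rewrite subr_eq0 => /eqP h; rewrite cdotZr conjcK h.
by field; rewrite fw ww.
Qed.

(** As a relation, adjointness can be used before existence is known and passes to sums and
    compositions without boundedness conditions; self-adjointness is [adj T T]. *)
Definition adj (R : realType) (H K : hilbertType R) (T : H -> K) (S : K -> H) : Prop :=
  forall x y, cdot (T x) y = cdot x (S y).

Section BoundedOps.
Variables (R : realType).
Implicit Types (H K L : hilbertType R).

Lemma opD H K (T : H -> K) x y : bounded_op T -> T (x + y) = T x + T y.
Proof. by case=> lT _; have := lT 1 x y; rewrite !scale1r. Qed.

Lemma op0 H K (T : H -> K) : bounded_op T -> T 0 = 0.
Proof.
by move=> bT; have /eqP := opD 0 0 bT; rewrite addr0 -subr_eq0 opprD addNKr oppr_eq0 => /eqP.
Qed.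

Lemma opZ H K (T : H -> K) a x : bounded_op T -> T (a *: x) = a *: T x.
Proof. by move=> bT; rewrite -[_ *: _]addr0 (proj1 bT) (op0 bT) addr0. Qed.

Lemma opN H K (T : H -> K) x : bounded_op T -> T (- x) = - T x.
Proof. by move=> bT; rewrite -scaleN1r opZ // scaleN1r. Qed.

Lemma opB H K (T : H -> K) x y : bounded_op T -> T (x - y) = T x - T y.
Proof. by move=> bT; rewrite opD // opN. Qed.

Lemma adj_sym H K (T : H -> K) (S : K -> H) : adj T S -> adj S T.
Proof. by move=> h x y; rewrite cdotC -h -cdotC. Qed.

Lemma adj_uniq H K (T : H -> K) (S S' : K -> H) : adj T S -> adj T S' -> S = S'.
Proof. by move=> h h'; apply/funext => y; apply: cdot_injr => x; rewrite -h h'. Qed.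

Lemma adj_adjoint H K (T : H -> K) (S : K -> H) : adj T S -> adjoint T = S.
Proof.
by move=> h; apply: xget_unique => // S' hS'; apply: (@adj_uniq H K T).
Qed.

Lemma adjointP H K (T : H -> K) : bounded_op T -> adj T (adjoint T).
Proof.
move=> bT; apply: (xgetPex 0).
suff /choice[S hS] : forall y, exists z, forall x, cdot (T x) y = cdot x z.
  by exists S => x y; exact: hS.
move=> y; apply: riesz => [a x z|].
  by rewrite opD // opZ // cdotDl cdotZl.
have [_ [c c0 Tc]] := (bounded_opP T).1 bT.
exists (c * hnorm y) => [|x]; first by rewrite mulr_ge0 ?hnorm_ge0.
apply: le_trans (normc_dot_CS _ _) _.
by rewrite mulrAC ler_wpM2r ?hnorm_ge0.
Qed.

Lemma adj_rdot H K (T : H -> K) (S : K -> H) x y :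
  adj T S -> rdot (T x) y = rdot x (S y).
Proof. by move=> h; rewrite /rdot h. Qed.

Lemma adj_linear H K (T : H -> K) (S : K -> H) : adj T S -> linear S.
Proof.
move=> h a x y; apply: cdot_injr => z.
by rewrite cdotDr cdotZr -!h cdotDr cdotZr.
Qed.

Lemma adj_opbound H K (T : H -> K) (S : K -> H) c : adj T S -> 0 <= c -> opbound T c -> opbound S c.
Proof.
move=> h c0 Tc x.
have : hnorm (S x) ^+ 2 <= hnorm (S x) * (c * hnorm x).
  rewrite sqr_hnorm /rdot -h -[complex.Re _]/(rdot _ _).
  apply: le_trans (rdot_CS _ _) _.
  by rewrite mulrA ler_wpM2r ?hnorm_ge0 // mulrC.
have [->|y0] := eqVneq (hnorm (S x)) 0; first by rewrite mulr_ge0 ?hnorm_ge0.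
by rewrite expr2 ler_pM2l // lt0r y0 hnorm_ge0.
Qed.

Lemma adj_bounded H K (T : H -> K) (S : K -> H) : adj T S -> bounded_op T -> bounded_op S.
Proof.
move=> h /bounded_opP[lT [c c0 Tc]]; apply/bounded_opP; split.
  exact: (adj_linear h).
by exists c => //; exact: (adj_opbound h).
Qed.

Lemma bounded_adjoint H K (T : H -> K) : bounded_op T -> bounded_op (adjoint T).
Proof. by move=> bT; exact: adj_bounded (adjointP bT) bT. Qed.

Lemma bounded_comp H K L (S : K -> L) (T : H -> K) :
  bounded_op S -> bounded_op T -> bounded_op (S \o T).
Proof.
move=> bS bT; apply/bounded_opP; split.
  by move=> a x y /=; rewrite (proj1 bT) (proj1 bS).
have [_ [c c0 Sc]] := (bounded_opP S).1 bS.
have [_ [d d0 Td]] := (bounded_opP T).1 bT.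
exists (c * d) => [|x /=]; first exact: mulr_ge0.
by apply: le_trans (Sc _) _; rewrite -mulrA ler_wpM2l.
Qed.

Lemma bounded_comp3 H K L (M : hilbertType R) (A : L -> M) (S : K -> L) (T : H -> K) :
  bounded_op A -> bounded_op S -> bounded_op T -> bounded_op (A \o S \o T).
Proof. by move=> bA bS bT; apply: bounded_comp => //; exact: bounded_comp. Qed.

Lemma opbound_id H : opbound (idfun : H -> H) 1.
Proof. by move=> x; rewrite mul1r. Qed.

Lemma bounded_id H : bounded_op (idfun : H -> H).
Proof. by apply/bounded_opP; split => //; exists 1 => //; exact: opbound_id. Qed.

Lemma opbound0 H K : opbound (0 : H -> K) 0.
Proof. by move=> x; rewrite /= [X in hnorm X]/(0 : K) hnorm0 mul0r. Qed.

Lemma bounded0 H K : bounded_op (0 : H -> K).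
Proof.
apply/bounded_opP; split => [a x y|]; last by exists 0 => //; exact: opbound0.
by rewrite /= scaler0 addr0.
Qed.

Lemma opboundD H K (S T : H -> K) c d : opbound S c -> opbound T d -> opbound (S + T) (c + d).
Proof. by move=> Sc Td x; apply: le_trans (hnormD _ _) _; rewrite mulrDl lerD. Qed.

Lemma bounded_add H K (S T : H -> K) : bounded_op S -> bounded_op T -> bounded_op (S + T).
Proof.
move=> bS bT; apply/bounded_opP; split.
  move=> a x y; rewrite -![(S + T) _]/(S _ + T _) (proj1 bT) (proj1 bS).
  by rewrite scalerDr addrACA.
have [_ [c c0 Sc]] := (bounded_opP S).1 bS.
have [_ [d d0 Td]] := (bounded_opP T).1 bT.
by exists (c + d); [exact: addr_ge0 | exact: opboundD].
Qed.

Lemma bounded_scale H K a (T : H -> K) : bounded_op T -> bounded_op (a *: T).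
Proof.
move=> bT; apply/bounded_opP; split.
  move=> b x y; rewrite -![(a *: T) _]/(a *: T _) (proj1 bT).
  by rewrite scalerDr !scalerA mulrC.
have [_ [d d0 Td]] := (bounded_opP T).1 bT.
have a0 : 0 <= complex.Re `|a| by rewrite -ler0c RRe_real ?ger0_real.
exists (complex.Re `|a| * d) => [|x]; first exact: mulr_ge0.
by rewrite -![(a *: T) _]/(a *: T _) hnormZ -mulrA ler_wpM2l.
Qed.

Lemma opp_scale H K (T : H -> K) : - T = (-1 : R[i]) *: T.
Proof. by rewrite scaleN1r. Qed.

Lemma bounded_opp H K (T : H -> K) : bounded_op T -> bounded_op (- T).
Proof. by move=> bT; rewrite opp_scale; exact: bounded_scale. Qed.

Lemma bounded_sub H K (S T : H -> K) : bounded_op S -> bounded_op T -> bounded_op (S - T).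
Proof. by move=> bS bT; apply: bounded_add => //; exact: bounded_opp. Qed.

Lemma adj_comp H K L (S : K -> L) S' (T : H -> K) T' :
  adj S S' -> adj T T' -> adj (S \o T) (T' \o S').
Proof. by move=> hS hT x y /=; rewrite hS hT. Qed.

Lemma adj_add H K (S T : H -> K) S' T' :
  adj S S' -> adj T T' -> adj (S + T) (S' + T').
Proof.
by move=> hS hT x y; rewrite -[(S + T) _]/(S _ + T _) cdotDl hS hT -cdotDr.
Qed.

Lemma adj_scale H K a (T : H -> K) T' : adj T T' -> adj (a *: T) (a^*%C *: T').
Proof.
move=> hT x y; rewrite -[(a *: T) _]/(a *: T _) cdotZl hT.
by rewrite -[(_ *: T') _]/(_ *: T' _) cdotZr conjcK.
Qed.

Lemma adj_opp H K (T : H -> K) T' : adj T T' -> adj (- T) (- T').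
Proof. by move=> hT x y; rewrite -[(- T) _]/(- T _) cdotNl hT -cdotNr. Qed.

Lemma adj_id H : adj (idfun : H -> H) idfun.
Proof. by []. Qed.

Lemma adj0 H K : adj (0 : H -> K) 0.
Proof.
move=> x y; rewrite -[(0 : H -> K) x]/(0 : K) cdot0l.
by rewrite -[(0 : K -> H) y]/(0 : H) cdot0r.
Qed.

Lemma norm_le1 H (x : H) : (`|x| <= 1) = (hnorm x <= 1).
Proof. by rewrite norm_hnorm -[1]/((1 : R)%:C%C) lecR. Qed.

Lemma opnorm_le H K (T : H -> K) c : 0 <= c -> opbound T c -> opnorm T <= c.
Proof.
move=> c0 Tc; apply: ge_sup.
  by exists (hnorm (T 0)), 0 => //=; rewrite normr0.
move=> _ [x /= x1 <-]; apply: le_trans (Tc x) _.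
by rewrite ler_piMr // -norm_le1.
Qed.

Lemma opbound_opnorm H K (T : H -> K) : bounded_op T -> opbound T (opnorm T).
Proof.
move=> bT x; have [_ [c c0 Tc]] := (bounded_opP T).1 bT.
have [x0|x0] := eqVneq (hnorm x) 0; first by rewrite (hnorm_eq0 x0) op0 // !hnorm0 mulr0.
have xp : 0 < hnorm x by rewrite lt0r x0 hnorm_ge0.
have : hnorm (T ((hnorm x)^-1%:C%C *: x)) <= opnorm T.
  apply: ub_le_sup; last first.
    exists ((hnorm x)^-1%:C%C *: x) => //=.
    by rewrite norm_le1 hnormZr ger0_norm ?invr_ge0 ?hnorm_ge0 // mulVf.
  exists c => _ [y /= y1 <-]; apply: le_trans (Tc y) _.
  by rewrite norm_le1 in y1; rewrite ler_piMr.
by rewrite opZ // hnormZr ger0_norm ?invr_ge0 ?hnorm_ge0 // ler_pdivrMl // mulrC.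
Qed.

Lemma opbound_le H K (T : H -> K) c d : c <= d -> opbound T c -> opbound T d.
Proof. by move=> cd Tc x; apply: le_trans (Tc x) _; rewrite ler_wpM2r ?hnorm_ge0. Qed.

End BoundedOps.

(** * Norm limits and C*-subalgebras *)

(** [ring] does not apply to vectors; pairing with an arbitrary vector turns a linear identity into
    one between scalars. *)
Ltac vec := apply: cdot_inj => ?; rewrite ?(cdotDl, cdotNl, cdotZl, cdot0l); ring.

Section OpEval.
Variables (R : realType) (H K : hilbertType R).
Implicit Types (S T : H -> K) (x : H).

Lemma addfE S T x : (S + T) x = S x + T x. Proof. by []. Qed.
Lemma oppfE T x : (- T) x = - T x. Proof. by []. Qed.
Lemma scalefE (a : R[i]) T x : (a *: T) x = a *: T x. Proof. by []. Qed.
Lemma zerofE x : (0 : H -> K) x = 0. Proof. by []. Qed.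

End OpEval.

Definition opE := (addfE, oppfE, scalefE, zerofE, compE).

(** These sequences serve as error bounds, so only an upper estimate is asked for and negative terms
    are harmless. *)
Definition small (R : realType) (e : nat -> R) : Prop :=
  forall eps, 0 < eps -> exists N, forall n, (N <= n)%N -> e n <= eps.

Section Small.
Variable R : realType.
Implicit Types (e f : nat -> R).

Lemma small_scale c e : 0 <= c -> small e -> small (fun n => c * e n).
Proof.
move=> c0 es eps eps0; have c1 : 0 < c + 1 by rewrite ltr_wpDl.
have [N hN] := es _ (divr_gt0 eps0 c1); exists N => n /hN.
by rewrite ler_pdivlMr // => h; nra.
Qed.

Lemma small_add e f : small e -> small f -> small (fun n => e n + f n).
Proof.
move=> es fs eps eps0; have e2 : 0 < eps / 2 by rewrite divr_gt0.
have [N hN] := es _ e2; have [M hM] := fs _ e2.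
exists (maxn N M) => n; rewrite geq_max => /andP[/hN h1 /hM h2].
by rewrite [leRHS]splitr lerD.
Qed.

Lemma small_le e f : (forall n, f n <= e n) -> small e -> small f.
Proof.
move=> h es eps /es[N hN]; exists N => n /hN; exact: le_trans.
Qed.

Lemma le_small_seq a b e : small e -> (forall n, a <= b + e n) -> a <= b.
Proof.
move=> es h; apply/ler_addgt0Pr => eps /es[N hN].
by apply: le_trans (h N) _; rewrite lerD2l hN.
Qed.

(** The distance to the supremum is the rate, so the speed of convergence of [t] never has to be
    computed. *)
Lemma monotone_small (t : nat -> R) B :
  (forall n, t n <= t n.+1) -> (forall n, t n <= B) ->
  exists2 e, small e & forall m n, (n <= m)%N -> t m - t n <= e n.
Proof.
move=> tm tB; have tle n m : (n <= m)%N -> t n <= t m.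
  by move: n m; apply: (homo_leq (@lexx _ R) (fun y x z => @le_trans _ R y x z) tm).
have ub : has_ubound (range t) by exists B => _ [n _ <-].
exists (fun n => sup (range t) - t n).
  move=> eps eps0; have hs : has_sup (range t) by split => //; exists (t 0), 0.
  have [_ [N _ <-] hN] := sup_adherent eps0 hs.
  exists N => n /tle Nn; lra.
by move=> m n _; rewrite lerD2r; apply: ub_le_sup => //; exists m.
Qed.

End Small.

Section OpLimit.
Variables (R : realType) (H K : hilbertType R).
Implicit Types (T : H -> K).

Lemma opbound_small0 T (e : nat -> R) : small e -> (forall n, opbound T (e n)) -> T = 0.
Proof.
move=> es Te; apply/funext => x; apply: hnorm_eq0; apply/eqP.
rewrite eq_le hnorm_ge0 andbT.
apply: (le_small_seq (small_scale (hnorm_ge0 x) es)) => n.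
by rewrite add0r mulrC; exact: Te.
Qed.

Lemma op_limit (T : nat -> H -> K) (e : nat -> R) :
  (forall n, bounded_op (T n)) -> small e ->
  (forall m n, (n <= m)%N -> opbound (T m - T n) (e n)) ->
  exists2 L, bounded_op L & forall n, opbound (L - T n) (e n).
Proof.
move=> bT es Te.
have /choice[L hL] : forall x, exists l, forall n, hnorm (l - T n x) <= hnorm x * e n.
  move=> x; apply: hcomplete; first exact: small_scale (hnorm_ge0 x) es.
  by move=> m n /Te/(_ x); rewrite mulrC.
have Le n : opbound (L - T n) (e n) by move=> x; rewrite mulrC; exact: hL.
exists L => //; apply/bounded_opP; split.
  move=> a x y; apply/eqP; rewrite -subr_eq0; apply/eqP/hnorm_eq0/eqP.
  rewrite eq_le hnorm_ge0 andbT.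
  set s := _ - _; pose z := a *: x + y.
  have hs n : hnorm s <= 0 + ((hnorm z + complex.Re `|a| * hnorm x) + hnorm y) * e n.
    have -> : s = (L z - T n z) - a *: (L x - T n x) - (L y - T n y).
      by rewrite /s (proj1 (bT n) a x y); vec.
    rewrite add0r !mulrDl.
    apply: le_trans (hnormB _ _) _; apply: lerD (hL _ _).
    apply: le_trans (hnormB _ _) _; apply: lerD (hL _ _) _.
    by rewrite hnormZ -mulrA ler_wpM2l // -ler0c RRe_real ?ger0_real.
  apply: le_small_seq hs; apply: small_scale => //.
  by rewrite !addr_ge0 ?mulr_ge0 ?hnorm_ge0 // -ler0c RRe_real ?ger0_real.
have [_ [c c0 Tc]] := (bounded_opP (T 0)).1 (bT 0%N).
exists (`|e 0%N| + c) => [|x]; first by rewrite addr_ge0.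
have -> : L x = (L x - T 0 x) + T 0 x by rewrite subrK.
apply: le_trans (hnormD _ _) _; rewrite mulrDl; apply: lerD (Tc x).
by apply: le_trans (hL _ _) _; rewrite mulrC ler_wpM2r ?hnorm_ge0 ?ler_norm.
Qed.

(** Scalar domination: the operator increments telescope below those of [t]. The last clause lets a
    caller deduce from [e] that the scalar increments tend to 0. *)
Lemma op_limit_monotone (T : nat -> H -> K) (t : nat -> R) B :
  (forall n, bounded_op (T n)) ->
  (forall n, t n <= t n.+1) -> (forall n, t n <= B) ->
  (forall n, opbound (T n.+1 - T n) (t n.+1 - t n)) ->
  exists L e, [/\ bounded_op L, small e, forall n, opbound (L - T n) (e n) &
    forall n, t n.+1 - t n <= e n].
Proof.
move=> bT tm tB Tt; have [e es te] := monotone_small tm tB.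
have [|L bL Le] := op_limit bT es; last by exists L, e; split => // n; exact: te.
move=> m n nm; apply: (opbound_le (te _ _ nm)).
elim: m nm => [|m IH]; first by rewrite leqn0 => /eqP -> x; rewrite !subrr mul0r hnorm0.
rewrite leq_eqVlt => /predU1P[->|/IH h] x; first by rewrite !subrr mul0r hnorm0.
have -> : (T m.+1 - T n) x = (T m.+1 - T m) x + (T m - T n) x.
  by rewrite !opE addrA subrK.
apply: le_trans (hnormD _ _) _; apply: le_trans (lerD (Tt m x) (h x)) _.
by rewrite -mulrDl addrA subrK.
Qed.

End OpLimit.

Section CstarTools.
Variables (R : realType) (H : hilbertType R).
Implicit Types (A : set (H -> H)) (S T X : H -> H).

Lemma Cstar_closed_opbound A T : Cstar_subalgebra A -> bounded_op T ->
  (forall eps, 0 < eps -> exists2 S, A S & opbound (T - S) eps) -> A T.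
Proof.
move=> CA bT h; apply: (Cstar_closed CA) => // e e0.
have e2 : 0 < e / 2 by rewrite divr_gt0.
have [S AS TS] := h _ e2; exists S => //.
by apply: le_lt_trans (opnorm_le (ltW e2) TS) _; lra.
Qed.

Lemma Cstar_lim A T (S : nat -> H -> H) (e : nat -> R) :
  Cstar_subalgebra A -> bounded_op T -> small e -> (forall n, A (S n)) ->
  (forall n, opbound (T - S n) (e n)) -> A T.
Proof.
move=> CA bT es AS TS; apply: Cstar_closed_opbound => // eps /es[N hN].
by exists (S N) => //; apply: opbound_le (TS N); exact: hN.
Qed.

Lemma Cstar_sub A S T : Cstar_subalgebra A -> A S -> A T -> A (S - T).
Proof.
move=> CA AS AT; apply: (Cstar_add CA) => //.
by rewrite opp_scale; exact: (Cstar_scale CA).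
Qed.

Lemma Build_Cstar_opbound A :
  (forall T, A T -> bounded_op T) -> A 0 ->
  (forall S T, A S -> A T -> A (S + T)) ->
  (forall (a : R[i]) T, A T -> A (a *: T)) ->
  (forall S T, A S -> A T -> A (S \o T)) ->
  (forall T, A T -> A (adjoint T)) ->
  (forall T, bounded_op T ->
    (forall e : R, 0 < e -> exists2 S, A S & opbound (T - S) e) -> A T) ->
  Cstar_subalgebra A.
Proof.
move=> Ab A0 AD AZ AM Aa Ac; split => // T bT h; apply: Ac => // e /h[S AS TS].
exists S => //; apply: opbound_le (ltW TS) (opbound_opnorm _).
by apply: bounded_sub => //; exact: Ab.
Qed.

Lemma Cstar_bounded_ops : Cstar_subalgebra [set T : H -> H | bounded_op T].
Proof.
apply: Build_Cstar_opbound => //=.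
- exact: bounded0.
- by move=> S T; exact: bounded_add.
- by move=> a T; exact: bounded_scale.
- by move=> S T; exact: bounded_comp.
- by move=> T; exact: bounded_adjoint.
Qed.

Lemma Cstar_gen_mem T : Cstar_gen T T.
Proof. by move=> A [_]; apply. Qed.

Lemma Cstar_gen_min A T : Cstar_subalgebra A -> A T -> Cstar_gen T `<=` A.
Proof. by move=> CA AT S; apply; split => // _ ->. Qed.

Lemma Cstar_gen_Cstar T : bounded_op T -> Cstar_subalgebra (Cstar_gen T).
Proof.
move=> bT; apply: Build_Cstar_opbound.
- by move=> S /(Cstar_gen_min Cstar_bounded_ops bT).
- by move=> A [CA _]; exact: (Cstar_zero CA).
- by move=> S S' hS hS' A hA; apply: (Cstar_add hA.1); [exact: hS|exact: hS'].
- by move=> a S hS A hA; apply: (Cstar_scale hA.1); exact: hS.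
- by move=> S S' hS hS' A hA; apply: (Cstar_comp hA.1); [exact: hS|exact: hS'].
- by move=> S hS A hA; apply: (Cstar_adjoint hA.1); exact: hS.
- move=> S bS hS A hA; apply: (Cstar_closed_opbound hA.1) => // e /hS[S' hS' ?].
  by exists S' => //; exact: hS'.
Qed.

(** For the uniqueness of square roots: an operator in every C*-subalgebra containing [B] commutes
    with each self-adjoint operator that commutes with [B]. *)
Lemma commutant_Cstar T : bounded_op T -> adj T T ->
  Cstar_subalgebra [set S | bounded_op S /\ S \o T = T \o S].
Proof.
move=> bT aT; apply: Build_Cstar_opbound => /=.
- by move=> S [].
- split; first exact: bounded0.
  by apply/funext => x; rewrite !opE op0.
- move=> S S' [bS hS] [bS' hS']; split; first exact: bounded_add.
  apply/funext => x; rewrite /= !opE opD //.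
  by rewrite -[T (S x)]/((T \o S) x) -hS -[T (S' x)]/((T \o S') x) -hS'.
- move=> a S [bS hS]; split; first exact: bounded_scale.
  by apply/funext => x; rewrite /= !opE opZ // -[T (S x)]/((T \o S) x) -hS.
- move=> S S' [bS hS] [bS' hS']; split; first exact: bounded_comp.
  by rewrite -compA hS' compA hS compA.
- move=> S [bS hS]; split; first exact: bounded_adjoint.
  have h1 := adj_comp (adjointP bS) aT; have h2 := adj_comp aT (adjointP bS).
  by rewrite hS in h1; rewrite (adj_uniq h1 h2).
- move=> S bS h; split => //; apply/eqP; rewrite -subr_eq0; apply/eqP.
  have [_ [c c0 Tc]] := (bounded_opP T).1 bT.
  apply: (@opbound_small0 _ _ _ _ (fun n => 2 * c * n.+1%:R^-1)) => [|n x].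
    by move=> eps; apply: harmonic_small; rewrite mulr_ge0.
  have [|S' [bS' hS'] SS'] := h n.+1%:R^-1; first by rewrite invr_gt0 ltr0n.
  have -> : ((S \o T) - (T \o S)) x = (S - S') (T x) - T ((S - S') x).
    rewrite !opE opB // -[T (S' x)]/((T \o S') x) -hS' /=; vec.
  apply: le_trans (hnormB _ _) _.
  have h1 := SS' (T x); have h2 := Tc ((S - S') x).
  have h3 := SS' x; have h4 := Tc x.
  have i0 : 0 <= n.+1%:R^-1 :> R by rewrite invr_ge0.
  have := ler_wpM2l i0 h4; have := ler_wpM2l c0 h3.
  by move: h1 h2; set i := n.+1%:R^-1; move: (hnorm _) (hnorm (T _)) => *; lra.
Qed.

End CstarTools.

(** * Positive operators, inverses and square roots *)

(** Since [rdot] sees only the real part, its positivity does not imply self-adjointness, which is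
    therefore a separate clause. *)
Definition pos_op (R : realType) (H : hilbertType R) (T : H -> H) : Prop :=
  [/\ bounded_op T, adj T T & forall x, 0 <= rdot (T x) x].

Section Positive.
Variables (R : realType) (H : hilbertType R).
Implicit Types (A : set (H -> H)) (S T X : H -> H) (x y : H).

(* Polarization: a form with real diagonal values is Hermitian. *)
Lemma positive_opP T : positive_op T <-> pos_op T.
Proof.
split=> [[bT hT]|[bT aT hT]].
  split => // [|x]; last by have := hT x; rewrite lecE /= => /andP[].
  have hr z : cdot (T z) z = cdot z (T z).
    rewrite [RHS]cdotC; have := hT z; rewrite -/(cdot _ _) lecE /=.
    by case: (cdot (T z) z) => u v /= /andP[/eqP -> _]; rewrite oppr0.
  pose E u v := cdot (T u) v - cdot u (T v).
  have E0 u : E u u = 0 by rewrite /E hr subrr.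
  move=> x y; apply/eqP; rewrite -subr_eq0 -/(E x y); apply/eqP.
  have e1 u v : E u v + E v u = 0.
    have <- : E (u + v) (u + v) = E u v + E v u; last exact: E0.
    transitivity (E u u + (E u v + E v u) + E v v); last by rewrite !E0 add0r addr0.
    by rewrite /E opD // !cdotDl !cdotDr; ring.
  have e2 : 'i%C * (E x y - E y x) = 0.
    rewrite -(e1 ('i%C *: x) y) /E opZ // !cdotZl !cdotZr.
    have -> : 'i^*%C = - 'i%C :> R[i] by apply/eqP; rewrite eq_complex /= oppr0 !eqxx.
    ring.
  move/eqP: e2; rewrite mulf_eq0 => /orP[/eqP/(congr1 (@complex.Im R))/eqP|/eqP e2].
    by rewrite /= oner_eq0.
  have : E x y *+ 2 = 0.
    have -> : E x y *+ 2 = (E x y + E y x) + (E x y - E y x) by ring.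
    by rewrite e1 e2 addr0.
  by move/eqP; rewrite mulrn_eq0 /= => /eqP.
split => // x; rewrite -/(cdot _ _) lecE /=; apply/andP; split; last exact: hT.
have : cdot (T x) x = (cdot (T x) x)^*%C by rewrite -cdotC aT.
case: (cdot (T x) x) => u v /eqP; rewrite eq_complex /= => /andP[_ h].
by rewrite -addr_eq0 -mulr2n mulrn_eq0 /= in h.
Qed.

Lemma pos_bounded T : pos_op T -> bounded_op T. Proof. by case. Qed.
Lemma pos_adj T : pos_op T -> adj T T. Proof. by case. Qed.

Lemma pos_CS T x y : pos_op T ->
  rdot (T x) y ^+ 2 <= rdot (T x) x * rdot (T y) y.
Proof.
case=> bT aT hT; apply: quad_discr => t.
have := hT (x + t%:C%C *: y).
rewrite opD // opZ // !rdotE (adj_rdot y x aT) (rdotC y) => h.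
by move: h; congr (0 <= _); ring.
Qed.

(** This is T^2 <= M T without a square root of T. Cauchy-Schwarz for the form of [T] at [x] and
    [T x] bounds the fourth power of [hnorm (T x)] by [rdot (T x) x * (M * hnorm (T x) ^+ 2)]; then
    divide. *)
Lemma pos_sqr T M x : pos_op T -> opbound T M -> hnorm (T x) ^+ 2 <= M * rdot (T x) x.
Proof.
move=> pT TM; have [->|Tx0] := eqVneq (hnorm (T x)) 0.
  rewrite expr0n /=.
  have [x0|x0] := eqVneq (hnorm x) 0; first by rewrite (hnorm_eq0 x0) rdot0r mulr0.
  apply: mulr_ge0; last by case: pT.
  have xp : 0 < hnorm x by rewrite lt0r x0 hnorm_ge0.
  by rewrite -(pmulr_lge0 _ xp); apply: le_trans (TM x); exact: hnorm_ge0.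
have := pos_CS x (T x) pT; rewrite -sqr_hnorm => h1.
have h2 : rdot (T (T x)) (T x) <= M * hnorm (T x) ^+ 2.
  apply: le_trans (rdot_CS _ _) _; rewrite expr2 mulrA.
  by rewrite ler_wpM2r ?hnorm_ge0.
have h3 : 0 <= rdot (T x) x by case: pT.
have h4 : 0 < hnorm (T x) ^+ 2 by rewrite exprn_gt0 // lt0r Tx0 hnorm_ge0.
rewrite -(ler_pM2r h4) -expr2; apply: le_trans h1 _.
by move: (ler_wpM2l h3 h2); congr (_ <= _); ring.
Qed.

Lemma pos_ker T x : pos_op T -> rdot (T x) x = 0 -> T x = 0.
Proof.
move=> pT h; apply: hnorm_eq0; apply/eqP; rewrite -sqrf_eq0 sqr_hnorm -sqrf_eq0 eq_le sqr_ge0.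
by have := pos_CS x (T x) pT; rewrite h mul0r andbT.
Qed.

Lemma pos_sandwich T S S' : bounded_op S -> adj S S' -> pos_op T ->
  pos_op (S' \o T \o S).
Proof.
move=> bS aS [bT aT hT]; split => [||x].
- by apply: bounded_comp => //; apply: bounded_comp => //; exact: adj_bounded aS bS.
- by move=> x y /=; rewrite (adj_sym aS) aT aS.
- by rewrite /= (adj_rdot _ _ (adj_sym aS)).
Qed.

Lemma pos_id : pos_op (idfun : H -> H).
Proof.
split; [exact: bounded_id | exact: adj_id | move=> x].
by rewrite -sqr_hnorm sqr_ge0.
Qed.

Lemma pos_add S T : pos_op S -> pos_op T -> pos_op (S + T).
Proof.
move=> [bS aS hS] [bT aT hT]; split => [||x]; first exact: bounded_add.
  exact: adj_add.
by rewrite opE rdotDl addr_ge0.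
Qed.

Lemma real_adj_scale (r : R) T : adj T T -> adj (r%:C%C *: T) (r%:C%C *: T).
Proof.
move=> aT; have := adj_scale r%:C%C aT.
by rewrite conjc_real.
Qed.

Lemma pos_scale (r : R) T : 0 <= r -> pos_op T -> pos_op (r%:C%C *: T).
Proof.
move=> r0 [bT aT hT]; split => [||x]; first exact: bounded_scale.
  exact: real_adj_scale.
by rewrite opE rdotZl mulr_ge0.
Qed.

Lemma pos_square T : bounded_op T -> adj T T -> pos_op (T \o T).
Proof. by move=> bT aT; exact: pos_sandwich bT aT pos_id. Qed.

End Positive.

(** * Inverses of operators that are bounded below *)

Section Inverse.
Variables (R : realType) (H : hilbertType R) (X : H -> H) (d : R).
Hypotheses (bX : bounded_op X) (d0 : 0 < d).
Hypothesis Xd : forall x, d * hnorm x ^+ 2 <= rdot (X x) x.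

(** Expanding the square, ||x - c X x||^2 <= (1 - 2 c d + c^2 M^2) ||x||^2; the choice c = d / M^2
    minimizes the factor, with value 1 - d^2 / M^2. *)
Lemma coercive_contraction : exists c r : R, [/\ 0 < c, 0 <= r < 1 &
  opbound (idfun - c%:C%C *: X) r].
Proof.
have [_ [M0 M00 XM0]] := (bounded_opP X).1 bX.
(* Adding [d] ensures d <= M, so that the square root defining the ratio is of a nonnegative
   number. *)
pose M := M0 + d; have Mp : 0 < M by rewrite ltr_wpDl.
have XM : opbound X M by apply: opbound_le XM0; rewrite lerDl ltW.
have M2 : 0 < M ^+ 2 by rewrite exprn_gt0.
have q0 : 0 <= d ^+ 2 / M ^+ 2 by rewrite divr_ge0 ?sqr_ge0.
have q1 : d ^+ 2 / M ^+ 2 <= 1.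
  by rewrite ler_pdivrMr // mul1r ler_sqr ?nnegrE ?lerDr // ltW.
have q2 : 0 < d ^+ 2 / M ^+ 2 by rewrite divr_gt0 ?exprn_gt0.
exists (d / M ^+ 2), (Num.sqrt (1 - d ^+ 2 / M ^+ 2)); split.
- by rewrite divr_gt0.
- by rewrite sqrtr_ge0 /= -[ltRHS]sqrtr1 ltr_sqrt // ltrBlDr ltrDl.
move=> x; rewrite -ler_sqr ?nnegrE ?hnorm_ge0 ?mulr_ge0 ?sqrtr_ge0 ?hnorm_ge0 //.
rewrite exprMn sqr_sqrtr ?subr_ge0 // !opE hnormB_sqr rdotZr hnormZr exprMn.
rewrite real_normK ?num_real // rdotC.
have h1 := Xd x; have h2 : hnorm (X x) ^+ 2 <= M ^+ 2 * hnorm x ^+ 2.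
  by rewrite -exprMn ler_sqr ?nnegrE ?mulr_ge0 ?hnorm_ge0 ?(ltW Mp).
have -> : (1 - d ^+ 2 / M ^+ 2) * hnorm x ^+ 2 = hnorm x ^+ 2 -
    2 * (d / M ^+ 2) * (d * hnorm x ^+ 2) + (d / M ^+ 2) ^+ 2 * (M ^+ 2 * hnorm x ^+ 2).
  by field; rewrite gt_eqF.
have c0 : 0 <= d / M ^+ 2 by rewrite divr_ge0 ?sqr_ge0 // ltW.
apply: lerD; last by rewrite ler_wpM2l ?sqr_ge0.
by rewrite lerD2l lerN2 -(mulrA 2) ler_wpM2l // ler_wpM2l.
Qed.

(** Neumann series: [Y n] is c times the sum of the first n powers of 1 - c X, and 1 - X Y_n is the
    n-th power. As a polynomial in [X], [X \o Y n] has no constant term, so it lies in the algebra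
    before the unit is known to; its limit is the unit, after which [Y n] and its limit follow. *)
Lemma coercive_inverse : exists Y, [/\ is_op_inverse X Y,
  forall A, Cstar_subalgebra A -> A X -> A idfun & 
  forall A, Cstar_subalgebra A -> A X -> A Y].
Proof.
have [c [r [c0 /andP[r0 r1] cr]]] := coercive_contraction.
pose F S : H -> H := c%:C%C *: idfun + S - c%:C%C *: (X \o S).
pose Y n := iter n F 0.
have bY n : bounded_op (Y n).
  elim: n => [|n IH]; first exact: bounded0.
  apply: bounded_sub; last by apply/bounded_scale/bounded_comp.
  by apply: bounded_add => //; apply/bounded_scale/bounded_id.
have YS n x : Y n.+1 x = c%:C%C *: x + Y n x - c%:C%C *: X (Y n x) by [].
have E n : opbound (idfun - (X \o Y n)) (r ^+ n).
  elim: n => [|n IH] x; first by rewrite /= !opE /= op0 // subr0 mul1r.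
  rewrite exprS.
  have -> : (idfun - (X \o Y n.+1)) x =
      (idfun - c%:C%C *: X) ((idfun - (X \o Y n)) x).
    by rewrite !opE YS !(opD _ _ bX, opN _ bX, opZ _ _ bX) //=; vec.
  apply: le_trans (cr _) _; rewrite -mulrA ler_wpM2l //.
have [L [e [bL es Le te]]] : exists L e, [/\ bounded_op L, small e,
    forall n, opbound (L - Y n) (e n) & forall n, c * r ^+ n <= e n].
  (* The partial sums of the geometric series that dominates the Neumann series. *)
  pose t n := c * (1 - r ^+ n) / (1 - r).
  have r1' : 1 - r != 0 by rewrite subr_eq0 gt_eqF.
  have tS n : t n.+1 - t n = c * r ^+ n by rewrite /t exprS; field.
  have [||n x|L [e [bL es Le te]]] := @op_limit_monotone _ _ _ Y t (c / (1 - r)) bY.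
  - by move=> n; rewrite -subr_ge0 tS mulr_ge0 ?exprn_ge0 ?(ltW c0).
  - move=> n; rewrite /t ler_pM2r ?invr_gt0 ?subr_gt0 // ger_pMr //.
    by rewrite lerBlDr lerDl exprn_ge0.
  - rewrite tS; have -> : (Y n.+1 - Y n) x = c%:C%C *: ((idfun - (X \o Y n)) x).
      by rewrite !opE YS; vec.
    by rewrite hnormZr (gtr0_norm c0) -mulrA ler_wpM2l ?(ltW c0) //; exact: E.
  by exists L, e; split => // n; rewrite -tS.
(* The powers of [r] are, up to the factor [c], the scalar increments, and these lie below the error
   [e]. *)
have rs : small (fun n => r ^+ n).
  apply: (small_le (e := fun n => c^-1 * e n)).
    by move=> n; rewrite ler_pdivlMl.
  by apply: small_scale => //; rewrite invr_ge0 ltW.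
have [_ [M M0 XM]] := (bounded_opP X).1 bX.
have XL : X \o L = idfun.
  apply/esym/eqP; rewrite -subr_eq0; apply/eqP.
  apply: (opbound_small0 (small_add rs (small_scale M0 es))) => n x.
  have -> : (idfun - (X \o L)) x = (idfun - (X \o Y n)) x - X ((L - Y n) x).
    by rewrite !opE opB //; vec.
  apply: le_trans (hnormB _ _) _; rewrite mulrDl lerD ?E // -mulrA.
  by apply: le_trans (XM _) _; rewrite ler_wpM2l // Le.
have Xinj x : X x = 0 -> x = 0.
  move=> x0; apply: hnorm_eq0; apply/eqP; rewrite -sqrf_eq0 eq_le sqr_ge0 andbT.
  by have := Xd x; rewrite x0 rdot0l pmulr_rle0.
have LX : L \o X = idfun.
  apply/funext => x; apply/eqP; rewrite -subr_eq0; apply/eqP/Xinj.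
  by rewrite opB //= -[X (L _)]/((X \o L) _) XL subrr.
have AXY A n : Cstar_subalgebra A -> A X -> A (X \o Y n).
  move=> CA AX; elim: n => [|n IH].
    rewrite (_ : _ \o _ = 0); first exact: Cstar_zero.
    by apply/funext => x /=; rewrite opE op0.
  have -> : X \o Y n.+1 = c%:C%C *: X + (X \o Y n) - c%:C%C *: (X \o (X \o Y n)).
    by apply/funext => x; rewrite !opE YS !(opD _ _ bX, opN _ bX, opZ _ _ bX).
  apply: Cstar_sub => //; last exact/(Cstar_scale CA)/(Cstar_comp CA).
  by apply: (Cstar_add CA) => //; exact: (Cstar_scale CA).
have Aid A : Cstar_subalgebra A -> A X -> A idfun.
  by move=> CA AX; apply: (Cstar_lim CA (@bounded_id _ _) rs) E => n; exact: AXY.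
exists L; split => // A CA AX; apply: (Cstar_lim CA bL es) Le.
elim => [|n IH]; first exact: Cstar_zero.
apply: (Cstar_sub CA); last exact/(Cstar_scale CA)/(Cstar_comp CA).
by apply: (Cstar_add CA) => //; apply: (Cstar_scale CA); exact: Aid.
Qed.

End Inverse.

(** * Existence and uniqueness of positive square roots *)

Section SquareRoot.
Variables (R : realType) (H : hilbertType R).
Implicit Types (A : set (H -> H)) (B S T X Y : H -> H).

Lemma small_sqr (e f : nat -> R) : (forall n, f n ^+ 2 <= e n) -> small e -> small f.
Proof.
move=> h es eps eps0; have [N hN] := es _ (exprn_gt0 2 eps0).
exists N => n /hN hn'; have {h hn'} := le_trans (h n) hn'.
move=> h; apply: le_trans (ler_norm _) _.
by rewrite -ler_sqr ?nnegrE ?(ltW eps0) // real_normK ?num_real.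
Qed.

(* With [Z n = z n - W n] the recursion reads [Z n.+1 = (1 - B + Z n ^ 2) / 2],
   dominated by the scalar one with [1 - B] replaced by [1]. Iterating on [W n],
   a polynomial in [B] without constant term, keeps it in non-unital algebras. *)
Lemma sqrt_exists_contraction B : pos_op B -> opbound (idfun - B) 1 ->
  exists S, [/\ pos_op S, S \o S = B &
    forall A, Cstar_subalgebra A -> A B -> A S].
Proof.
move=> pB B1; have [bB aB hB] := pB.
pose z n := iter n (fun u : R => (1 + u ^+ 2) / 2) 0.
have zE n : z n.+1 = (1 + z n ^+ 2) / 2 by [].
have z01 n : 0 <= z n <= 1.
  elim: n => [|n /andP[z0 z1]]; first by rewrite /= lexx ler01.
  rewrite zE divr_ge0 ?addr_ge0 ?sqr_ge0 //= ler_pdivrMr // mul1r.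
  by have := expr_le1 (n := 2) isT z0; rewrite z1 => h; lra.
have z0 n : 0 <= z n by case/andP: (z01 n).
have z1 n : z n <= 1 by case/andP: (z01 n).
have zz n : z n <= z n.+1.
  by rewrite zE ler_pdivlMr //; have := sqr_ge0 (1 - z n); nra.
have zS n : z n.+1 - z n = (1 - z n) ^+ 2 / 2 by rewrite zE; field.
pose W := nat_rect (fun=> H -> H) 0 (fun n S =>
  (2^-1 : R[i]) *: (B + (2 * z n)%:C%C *: S - (S \o S))).
have WE n : W n.+1 = (2^-1 : R[i]) *: (B + (2 * z n)%:C%C *: W n - (W n \o W n)) by [].
have AW A n : Cstar_subalgebra A -> A B -> A (W n).
  move=> CA AB; elim: n => [|n IH]; first exact: Cstar_zero.
  rewrite WE; apply: (Cstar_scale CA); apply: (Cstar_sub CA); last exact: (Cstar_comp CA).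
  by apply: (Cstar_add CA) => //; exact: (Cstar_scale CA).
have bW n : bounded_op (W n) by exact: (AW _ n (@Cstar_bounded_ops _ _) bB).
have half : (2^-1 : R[i]) = (2^-1)%:C%C.
  by rewrite fmorphV /= -[2 in LHS](rmorph_nat (real_complex R)).
have aW n : adj (W n) (W n).
  elim: n => [|n IH]; first exact: adj0.
  rewrite WE half; apply: real_adj_scale; apply: adj_add; last exact/adj_opp/adj_comp.
  by apply: adj_add => //; exact: real_adj_scale.
have zC n : (z n.+1)%:C%C = (1 + (z n)%:C%C ^+ 2) * 2^-1 :> R[i].
  by rewrite zE rmorphM /= half rmorphD /= rmorphXn.
have z2C n : (2 * z n)%:C%C = 2 * (z n)%:C%C :> R[i].
  by rewrite rmorphM /= -[2 in RHS](rmorph_nat (real_complex R)).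
have hnh (x : H) : hnorm ((2^-1 : R[i]) *: x) = 2^-1 * hnorm x.
  by rewrite half hnormZr ger0_norm // invr_ge0.
pose Z n := (z n)%:C%C *: idfun - W n.
have ZS n x : Z n.+1 x = (2^-1 : R[i]) *: ((idfun - B) x + Z n (Z n x)).
  rewrite /Z WE !opE zC z2C /= !(opD _ _ (bW n), opN _ (bW n), opZ _ _ (bW n)).
  by apply: cdot_inj => w; rewrite ?(cdotDl, cdotNl, cdotZl); field.
have ZB n x y : Z n (x - y) = Z n x - Z n y.
  by rewrite /Z !opE /= (opB _ _ (bW n)); vec.
have Zz n : opbound (Z n) (z n).
  elim: n => [|n IH] x.
    by rewrite /Z !opE /= [X in X%:C%C]/0 scale0r subrr hnorm0 mul0r.
  rewrite ZS hnh zE [_ / 2]mulrC -mulrA ler_wpM2l ?invr_ge0 //.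
  apply: le_trans (hnormD _ _) _; rewrite mulrDl lerD ?B1 //.
  apply: le_trans (IH _) _; rewrite expr2 -mulrA.
  by rewrite ler_wpM2l ?IH.
have ZD n : opbound (Z n.+1 - Z n) (z n.+1 - z n).
  elim: n => [|n IH] x.
    have Z0 y : Z 0%N y = 0 by rewrite /Z !opE /= [X in X%:C%C]/0 scale0r subrr.
    rewrite !opE ZS !Z0 addr0 subr0 hnh zE [z 0%N]/0 expr0n addr0 subr0 mul1r.
    by rewrite ler_wpM2l ?invr_ge0 // -[leRHS]mul1r; exact: B1.
  (* The difference of two squares is split without commuting the factors, in the shape that the
     scalar difference z_{n+1}^2 - z_n^2 dominates. *)
  have -> : (Z n.+2 - Z n.+1) x = (2^-1 : R[i]) *:
      (Z n.+1 ((Z n.+1 - Z n) x) + (Z n.+1 - Z n) (Z n x)).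
    transitivity ((2^-1 : R[i]) *: ((idfun - B) x + Z n.+1 (Z n.+1 x))
        - (2^-1 : R[i]) *: ((idfun - B) x + Z n (Z n x))).
      by rewrite -!ZS.
    by rewrite !opE (ZB n.+1 (Z n.+1 x) (Z n x)); vec.
  rewrite hnh [z n.+2]zE {2}zE -mulrBl [_ / 2]mulrC -mulrA ler_wpM2l ?invr_ge0 //.
  apply: le_trans (hnormD _ _) _.
  have -> : (1 + z n.+1 ^+ 2 - (1 + z n ^+ 2)) * hnorm x =
    z n.+1 * ((z n.+1 - z n) * hnorm x) + (z n.+1 - z n) * (z n * hnorm x) by ring.
  apply: lerD.
    by apply: le_trans (Zz _ _) _; rewrite ler_wpM2l ?IH.
  by apply: le_trans (IH _) _; rewrite ler_wpM2l ?subr_ge0 ?Zz.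
have WD n : opbound (W n.+1 - W n) (2 * z n.+1 - 2 * z n).
  move=> x; have -> : (W n.+1 - W n) x = (z n.+1 - z n)%:C%C *: x - (Z n.+1 - Z n) x.
    by rewrite /Z !opE rmorphB /=; vec.
  apply: le_trans (hnormB _ _) _; rewrite hnormZr ger0_norm ?subr_ge0 //.
  by have := ZD n x; lra.
have [||L [e [bL es Le te]]] := op_limit_monotone (B := 2) bW _ _ WD.
- by move=> n; rewrite ler_wpM2l.
- by move=> n; rewrite -[leRHS]mulr1 ler_wpM2l.
have e0 n : 0 <= e n by apply: le_trans (te n); rewrite /= subr_ge0 ler_wpM2l.
(* The limit of [z] is identified from its increments: (1 - z n)^2 = 2 (z n.+1 - z n), which is at
   most [e n]. *)
have z1s : small (fun n => 1 - z n).
  apply: (@small_sqr e) => // n; apply: le_trans (te n).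
  by have := zS n; lra.
have aL : adj L L.
  suff aLL : adjoint L = L by have := adjointP bL; rewrite aLL.
  apply/eqP; rewrite -subr_eq0; apply/eqP.
  apply: (opbound_small0 (small_add es es)) => n.
  have h : opbound (adjoint L - W n) (e n).
    apply: adj_opbound (e0 n) (Le n); apply: adj_add (adjointP bL) _.
    exact: adj_opp.
  move=> x; have -> : (adjoint L - L) x = (adjoint L - W n) x - (L - W n) x.
    by rewrite !opE; vec.
  by apply: le_trans (hnormB _ _) _; rewrite mulrDl lerD ?Le ?h.
have W2 n : opbound (W n) 2.
  move=> x; have -> : W n x = (z n)%:C%C *: x - Z n x by rewrite /Z !opE; vec.
  apply: le_trans (hnormB _ _) _; rewrite mulr2n mulrDl lerD //.
    by rewrite hnormZr ger0_norm // ler_wpM2r ?hnorm_ge0.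
  by apply: le_trans (Zz _ _) _; rewrite ler_wpM2r ?hnorm_ge0.
have LL : L \o L = B.
  have [_ [c c0 Lc]] := (bounded_opP L).1 bL.
  have se : small (fun n => 2 * e n + 4 * (1 - z n) + (c * e n + 2 * e n)).
    by apply: small_add; apply: small_add; exact: small_scale.
  apply/esym/eqP; rewrite -subr_eq0; apply/eqP.
  apply: (opbound_small0 se) => n x.
  (* The recursion solved for [B] gives B - W_n^2 = 2 (W_{n+1} - W_n) + 2 (1 - z_n) W_n, and L^2 -
     W_n^2 = L (L - W_n) + (L - W_n) W_n. *)
  have -> : (B - (L \o L)) x = ((2 : R)%:C%C *: ((W n.+1 - W n) x)
      + (2 * (1 - z n))%:C%C *: W n x)
      - (L ((L - W n) x) + (L - W n) (W n x)).
    rewrite [W n.+1]WE ?opE (opB _ _ bL) z2C rmorphM rmorphB /=.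
    rewrite (rmorph_nat (real_complex R) 2).
    by apply: cdot_inj => w; rewrite ?(cdotDl, cdotNl, cdotZl); field.
  apply: le_trans (hnormB _ _) _; rewrite [leRHS]mulrDl lerD //.
    apply: le_trans (hnormD _ _) _; rewrite [leRHS]mulrDl lerD //.
      by rewrite hnormZr ger0_norm // -mulrA ler_wpM2l // (opbound_le (te n)).
    rewrite hnormZr ger0_norm ?mulr_ge0 ?subr_ge0 //.
    by have := W2 n x; have := z1 n; nra.
  apply: le_trans (hnormD _ _) _; rewrite [leRHS]mulrDl lerD //.
    by apply: le_trans (Lc _) _; rewrite -mulrA ler_wpM2l ?Le.
  by apply: le_trans (Le _ _) _; rewrite -mulrA mulrCA ler_wpM2l ?W2.
have L1 : opbound (idfun - L) 1.
  have se : small (fun n => (1 - z n) + e n) by exact: small_add.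
  move=> x; apply: (le_small_seq (small_scale (hnorm_ge0 x) se)) => n.
  have -> : (idfun - L) x = (1 - z n)%:C%C *: x + Z n x - (L - W n) x.
    by rewrite /Z !opE rmorphB /=; vec.
  apply: le_trans (hnormB _ _) _; rewrite /= [in leRHS]mulrDr [leRHS]addrA lerD //; last first.
    by rewrite mulrC; exact: Le.
  apply: le_trans (hnormD _ _) _; rewrite [leLHS]addrC lerD //.
    by apply: le_trans (Zz _ _) _; rewrite ler_wpM2r ?hnorm_ge0.
  by rewrite hnormZr mulrC ger0_norm ?subr_ge0.
exists L; split => //; last by move=> A CA AB; apply: (Cstar_lim CA bL es) Le => n; exact: AW.
(* Positivity follows from the bound on 1 - L: <L x, x> = ||x||^2 - <(1 - L) x, x> >= 0. *)
split => // x.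
have -> : L x = x - (idfun - L) x by rewrite !opE; vec.
rewrite rdotBl -sqr_hnorm subr_ge0; apply: le_trans (rdot_CS _ _) _.
by rewrite expr2 ler_wpM2r ?hnorm_ge0 // -[leRHS]mul1r.
Qed.

(** Division by a bound [M] reduces to the contraction case: by [pos_sqr], ||x - B x / M||^2 <=
    ||x||^2 - <B x, x> / M. *)
Lemma sqrt_exists B : pos_op B ->
  exists S, [/\ pos_op S, S \o S = B &
    forall A, Cstar_subalgebra A -> A B -> A S].
Proof.
move=> pB; have [bB aB hB] := pB.
have [_ [M0 M00 BM0]] := (bounded_opP B).1 bB.
pose M := M0 + 1; have Mp : 0 < M by rewrite ltr_wpDl.
have BM : opbound B M by apply: opbound_le BM0; rewrite lerDl.
have i0 : 0 <= M^-1 by rewrite invr_ge0 ltW.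
have [|S [pS SS AS]] := sqrt_exists_contraction (pos_scale i0 pB).
  move=> x; rewrite -ler_sqr ?nnegrE ?hnorm_ge0 ?mulr_ge0 ?hnorm_ge0 // mul1r !opE.
  rewrite hnormB_sqr rdotZr hnormZr ger0_norm // exprMn rdotC.
  have h1 := pos_sqr x pB BM; have h2 := hB x.
  have h3 : M^-1 ^+ 2 * hnorm (B x) ^+ 2 <= M^-1 * rdot (B x) x.
    rewrite expr2 -mulrA ler_wpM2l //.
    by rewrite ler_pdivrMl.
  by have := mulr_ge0 i0 h2; move: h3; set u := _ * _; set v := _ * rdot _ _ => *; lra.
exists ((Num.sqrt M)%:C%C *: S); split.
- exact: pos_scale (sqrtr_ge0 _) pS.
- apply/funext => x; rewrite !opE (opZ _ _ (pos_bounded pS)) scalerA -rmorphM /=.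
  rewrite -expr2 sqr_sqrtr ?(ltW Mp) // -[S (S x)]/((S \o S) x) SS opE scalerA.
  by rewrite -rmorphM /= mulfV ?gt_eqF // scale1r.
- by move=> A CA AB; apply: (Cstar_scale CA); apply: AS => //; exact: (Cstar_scale CA).
Qed.

(** With y = S x - T x one has (S + T) y = 0, so the nonnegative <S y, y> and <T y, y> vanish and S
    y = T y = 0. Then ||y||^2 = <x, S y - T y> = 0. *)
Lemma pos_square_inj_comm S T : pos_op S -> pos_op T ->
  S \o T = T \o S -> S \o S = T \o T -> S = T.
Proof.
move=> pS pT c e; have [[bS aS hS] [bT aT hT]] := (pS, pT).
have cE x : S (T x) = T (S x) by rewrite -[LHS]/((S \o T) x) c.
have eE x : S (S x) = T (T x) by rewrite -[LHS]/((S \o S) x) e.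
apply/funext => x; apply/eqP; rewrite -subr_eq0; apply/eqP/hnorm_eq0/eqP.
set y := S x - T x; have yE : S y + T y = 0.
  by rewrite /y (opB _ _ bS) (opB _ _ bT) eE cE; vec.
have h : rdot (S y) y + rdot (T y) y = 0 by rewrite -rdotDl yE rdot0l.
have h1 : rdot (S y) y = 0 by have := hS y; have := hT y; lra.
have h2 : rdot (T y) y = 0 by lra.
rewrite -sqrf_eq0 sqr_hnorm {1}/y rdotBl (adj_rdot _ _ aS) (adj_rdot _ _ aT).
by rewrite (pos_ker pS h1) (pos_ker pT h2) subrr.
Qed.

(** Both roots are compared with the constructed root [U], which lies in every C*-algebra containing
    the square, in particular in the commutants of [S] and of [T]. This reduces to commuting
    roots. *)
Lemma pos_square_inj S T : pos_op S -> pos_op T -> S \o S = T \o T -> S = T.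
Proof.
move=> pS pT e; have [bS aS hS] := pS.
have [U [pU UU AU]] := sqrt_exists (pos_square bS aS).
have comm V : pos_op V -> V \o V = S \o S -> V = U.
  move=> pV eV; have [bV aV _] := pV.
  have [] := AU _ (commutant_Cstar bV aV).
    by rewrite -eV; split=> //; exact: bounded_comp.
  by move=> _ UV; apply: pos_square_inj_comm => //; rewrite eV UU.
by rewrite (comm S) // (comm T).
Qed.

Lemma opsqrtE B S : pos_op S -> S \o S = B -> opsqrt B = S.
Proof.
move=> pS SB; apply: xget_unique; first by split => //; exact/positive_opP.
move=> T [/positive_opP pT TB]; apply: pos_square_inj => //.
by rewrite SB.
Qed.

Lemma opsqrtP B : pos_op B -> [/\ pos_op (opsqrt B), opsqrt B \o opsqrt B = B &
  forall A, Cstar_subalgebra A -> A B -> A (opsqrt B)].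
Proof. by move=> /sqrt_exists[S [pS SB AS]]; rewrite (opsqrtE pS SB). Qed.

Lemma op_inverseE X Y : is_op_inverse X Y -> op_inverse X = Y.
Proof.
move=> iY; apply: xget_unique => // Z [_ ZX _]; have [_ _ XY] := iY.
by rewrite -[Z]/(Z \o idfun) -XY compA ZX.
Qed.

End SquareRoot.

(** * The matched projection *)

Section MatchedProjection.
Variables (R : realType) (H : hilbertType R) (Q : H -> H).
Hypotheses (bQ : bounded_op Q) (QQ : forall x, Q (Q x) = Q x).

Local Notation Qs := (adjoint Q).
Local Notation a := (opabs Qs).
Local Notation m := (matched_projection Q).

Let aQ : adj Q Qs. Proof. exact: adjointP. Qed.
Let bQs : bounded_op Qs. Proof. exact: bounded_adjoint. Qed.
Let adjointQs : adjoint Qs = Q. Proof. exact/adj_adjoint/adj_sym. Qed.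

Lemma opabs_adjoint : pos_op a /\ forall x, a (a x) = Q (Qs x).
Proof.
have p : pos_op (adjoint Qs \o Qs).
  by rewrite adjointQs; exact: pos_sandwich bQs (adj_sym aQ) (pos_id H).
have [pa aa _] := opsqrtP p; split => // x.
by rewrite -[LHS]/((opabs Qs \o opabs Qs) x) aa /= adjointQs.
Qed.

Let pa : pos_op a. Proof. exact: opabs_adjoint.1. Qed.
Let aa x : a (a x) = Q (Qs x). Proof. exact: opabs_adjoint.2. Qed.
Let ba : bounded_op a. Proof. exact: pos_bounded pa. Qed.
Let adja : adj a a. Proof. exact: pos_adj pa. Qed.

Lemma opabs_ker x : Qs x = 0 -> a x = 0.
Proof.
move=> h; apply: hnorm_eq0; apply/eqP; rewrite -sqrf_eq0 sqr_hnorm.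
by rewrite (adj_rdot _ _ adja) aa h op0 // rdot0r.
Qed.

(** The range of a bounded idempotent is the set of its fixed points, hence closed. *)
Lemma range_projection : exists p : H -> H, [/\ bounded_op p, adj p p,
  forall x, Q (p x) = p x & forall x, p (Q x) = Q x].
Proof.
have Kcl : closed [set x | Q x = x].
  apply/closed_hnormP => l hl /=; apply/eqP; rewrite -subr_eq0; apply/eqP/hnorm_eq0/eqP.
  rewrite eq_le hnorm_ge0 andbT; apply/ler_addgt0Pr => e e0; rewrite add0r.
  have [_ [c c0 Qc]] := (bounded_opP Q).1 bQ.
  have c1 : 0 < c + 1 by rewrite ltr_wpDl.
  have [y Qy ly] := hl _ (divr_gt0 e0 c1).
  have -> : Q l - l = Q (l - y) - (l - y) by rewrite (opB _ _ bQ) Qy; vec.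
  move: ly; rewrite ltr_pdivlMr // => ly.
  by apply: le_trans (hnormB _ _) _; have := Qc (l - y); lra.
have KL (c : R[i]) x y : Q x = x -> Q y = y -> Q (c *: x + y) = c *: x + y.
  by move=> hx hy; rewrite (opD _ _ bQ) (opZ _ _ bQ) hx hy.
pose M := ClosedSubspace (op0 bQ : [set x | Q x = x] 0) KL Kcl.
exists (fun x => emb (orthproj M x)); split.
- apply/bounded_opP; split; last first.
    by exists 1 => // x; rewrite mul1r hnorm_emb orthproj_norm.
  by move=> c x y; rewrite orthproj_linear.
- by move=> x y; rewrite -[RHS]orthproj_adj [LHS]cdotC -orthproj_adj -cdotC.
- by move=> x; exact: (embP (orthproj M x)).
- move=> x; have [y <-] : exists y : M, emb y = Q x by apply: emb_surj; exact: QQ.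
  by rewrite orthproj_emb.
Qed.

(* With [p] the projection onto the range of [Q], the operator
   [Q Q^* + (1 - p)] is bounded below by [1], and [a (Q Q^* + (1 - p))^-1] is the
   Moore-Penrose inverse of [a]. *)
Lemma mp_inverse_opabs : exists p s : H -> H, [/\ mp_inverse a = s /\ bounded_op s,
  adj s s, forall x, a (s x) = p x /\ s (a x) = p x,
  forall x, p (a x) = a x /\ p (Q x) = Q x & forall x, a (Qs x) = a x /\ Q (a x) = a x].
Proof.
have [p [bp ap Qp pQ]] := range_projection.
have pp x : p (p x) = p x by rewrite -(Qp x) pQ.
have Qsp x : Qs (p x) = Qs x.
  by apply: cdot_injr => z; rewrite -(adj_comp ap aQ z x) /= pQ aQ.
have pQs x : p (Qs x) = p x.
  by apply: cdot_injr => z; rewrite -(adj_comp aQ ap z x) /= Qp ap.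
have a_p x : a (p x) = a x.
  apply/eqP; rewrite -subr_eq0 -(opB _ _ ba); apply/eqP/opabs_ker.
  by rewrite (opB _ _ bQs) Qsp subrr.
have p_a x : p (a x) = a x.
  apply: cdot_injr => z; rewrite -(adj_comp adja ap z x) /= a_p; exact: adja.
have aQs x : a (Qs x) = a x by rewrite -a_p pQs a_p.
have Qa x : Q (a x) = a x by rewrite -(p_a x) Qp.
pose X := (a \o a) + (idfun - p).
have bX : bounded_op X.
  apply: bounded_add; first exact: bounded_comp.
  by apply: bounded_sub => //; exact: bounded_id.
have X1 x : 1 * hnorm x ^+ 2 <= rdot (X x) x.
  rewrite mul1r /X !opE !rdotE (adj_rdot _ _ adja) -!sqr_hnorm.
  have -> : rdot (p x) x = hnorm (p x) ^+ 2.
    by rewrite sqr_hnorm [RHS](adj_rdot _ _ ap) pp rdotC.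
  (* Taking adjoints in Q p = p gives p Q^* = p, so ||p x|| <= ||Q^* x|| = ||a x||. Thus a^2 >= p,
     and adding 1 - p gives the lower bound 1. *)
  have h : hnorm (p x) <= hnorm (Qs x).
    rewrite -pQs; have : hnorm (p (Qs x)) ^+ 2 <= hnorm (p (Qs x)) * hnorm (Qs x).
      by rewrite sqr_hnorm (adj_rdot _ _ ap) pp rdotC rdot_CS.
    have [->|p0] := eqVneq (hnorm (p (Qs x))) 0; first by rewrite hnorm_ge0.
    by rewrite expr2 ler_pM2l // lt0r p0 hnorm_ge0.
  have -> : hnorm (a x) ^+ 2 = hnorm (Qs x) ^+ 2.
    by rewrite !sqr_hnorm (adj_rdot _ _ adja) aa (adj_rdot _ _ (adj_sym aQ)).
  move: h; rewrite -ler_sqr ?nnegrE ?hnorm_ge0 // => h; lra.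
have [Y [[bY YX XY] _ _]] := coercive_inverse bX ltr01 X1.
have YXE x : Y (X x) = x by rewrite -[LHS]/((Y \o X) x) YX.
have XYE x : X (Y x) = x by rewrite -[LHS]/((X \o Y) x) XY.
have aX x : a (X x) = X (a x).
  by rewrite /X !opE /= (opD _ _ ba) (opB _ _ ba) p_a a_p.
have pX x : p (X x) = a (a x).
  by rewrite /X !opE /= (opD _ _ bp) (opB _ _ bp) pp p_a subrr addr0.
have Xp x : X (p x) = a (a x).
  by rewrite /X !opE /= pp !a_p subrr addr0.
have aY x : a (Y x) = Y (a x) by rewrite -[LHS]YXE -aX XYE.
have as_ x : a (a (Y x)) = p x by rewrite -pX XYE.
have sa x : a (Y (a x)) = p x by rewrite -aY as_.
have adjX : adj X X.
  apply: adj_add; first exact: adj_comp.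
  by apply: adj_add; [exact: adj_id | exact: adj_opp].
have adjY : adj Y Y.
  by move=> x y; rewrite -{1}(XYE y) -adjX XYE.
have bs : bounded_op (a \o Y) by exact: bounded_comp.
have ads : adj (a \o Y) (a \o Y).
  have -> : a \o Y = Y \o a by apply/funext => x /=; rewrite aY.
  have := adj_comp adja adjY.
  by have -> : a \o Y = Y \o a by apply/funext => x /=; rewrite aY.
have psY x : p (a (Y x)) = a (Y x) by rewrite p_a.
have sp x : a (Y (p x)) = a (Y x) by rewrite aY a_p -aY.
exists p, (a \o Y); split => //; [split => // | by move=> x; split; rewrite /= ?as_ ?sa].
have asE : a \o (a \o Y) = p by apply/funext => x /=; rewrite as_.
have saE : (a \o Y) \o a = p by apply/funext => x /=; rewrite sa.
apply: xget_unique.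
  split => //.
  - by rewrite asE; apply/funext => x /=; rewrite p_a.
  - by rewrite saE; apply/funext => x /=; rewrite psY.
  - by rewrite asE; exact: adj_adjoint.
  - by rewrite saE; exact: adj_adjoint.
(* Uniqueness: [a \o S] and [S \o a] are self-adjoint and both turn out to be [p], after which S = S
   a S determines [S]. *)
move=> S [bS aSa SaS haS hSa].
have ad1 : adj (a \o S) (a \o S).
  by have := adjointP (bounded_comp ba bS); rewrite haS.
have ad2 : adj (S \o a) (S \o a).
  by have := adjointP (bounded_comp bS ba); rewrite hSa.
have aSaE x : a (S (a x)) = a x by rewrite -[LHS]/((a \o S \o a) x) aSa.
have aSE x : a (S x) = p x.
  apply: cdot_injr => z; rewrite -(ap z x) -{1}(p_a (S x)).
  by rewrite -ap -[RHS]/(cdot (p z) x) -(ad1 _ _) /= -{1}as_ aSaE as_.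
have SaE x : S (a x) = p x.
  apply: cdot_injr => z; rewrite -[LHS]/(cdot z ((S \o a) x)) -ad2 /= -{1}a_p.
  rewrite -[S (a _)]/((S \o a) _) ad2 /= ap.
  by rewrite -(sa (S (a x))) aSaE sa.
apply/funext => x.
by rewrite -{1}SaS /= SaE -sa aSE sp.
Qed.

(** With J = 2 m - 1 the inner conjunction reads Q^* = J Q J, J Q >= 0, and m = 0 on the common
    kernel of Q and its adjoint. These follow from a J = Q and Q J = a, since then Q^* = J a and J Q
    = J a J; the last clause is read off the formula for m. The decomposition uses nothing else
    about m. *)
Lemma matched_projectionP : [/\ bounded_op m, adj m m, forall x, m (m x) = m x &
  [/\ forall x, Qs x = 2 *: m (Q (2 *: m x - x)) - Q (2 *: m x - x),
    forall x, 0 <= rdot (2 *: m (Q x) - Q x) x &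
    forall x, Q x = 0 -> Qs x = 0 -> m x = 0]].
Proof.
have [p [s [[sE bs] ads asE pE aQE]]] := mp_inverse_opabs.
pose X := a + idfun.
have bX : bounded_op X by apply: bounded_add => //; exact: bounded_id.
have X1 x : 1 * hnorm x ^+ 2 <= rdot (X x) x.
  by rewrite /X !opE rdotDl mul1r -sqr_hnorm lerDr; case: pa.
have [b [ib _ _]] := coercive_inverse bX ltr01 X1.
have bE : op_inverse X = b by exact: op_inverseE.
have [bb bX' Xb'] := ib.
have bXE x : b (X x) = x by rewrite -[LHS]/((b \o X) x) bX'.
have XbE x : X (b x) = x by rewrite -[LHS]/((X \o b) x) Xb'.
have ab x : a (b x) = b (a x).
  have aX y : a (X y) = X (a y) by rewrite /X !opE (opD _ _ ba).
  by rewrite -[LHS]bXE -aX XbE.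
have adjb : adj b b.
  have adjX : adj X X by apply: adj_add => //; exact: adj_id.
  by move=> x y; rewrite -{1}(XbE y) -adjX XbE.
pose w x := s (b (a x + Q x)).
have mE x : m x = (2^-1 : R[i]) *: (a (w x) + Qs (w x)).
  by rewrite /matched_projection sE bE.
have two_m x : 2 *: m x = a (w x) + Qs (w x).
  by rewrite mE scalerA mulfV ?pnatr_eq0 // scale1r.
(* Since a s = p, the left side is p (1 + a) b (a + Q) x; the factor [b] cancels 1 + a, and a + Q
   maps into the range of [p]. *)
have aw x : a (w x) + a (a (w x)) = a x + Q x.
  have [h1 _] := asE (b (a x + Q x)).
  have ps y : p (a y) = a (p y) by have [<- _] := asE (a y); have [_ <-] := asE y.
  rewrite /w h1.
  have -> : p (b (a x + Q x)) + a (p (b (a x + Q x))) = p (X (b (a x + Q x))).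
    have [<- _] := asE (X (b (a x + Q x))); rewrite /X !opE /= (opD _ _ bs) (opD _ _ ba).
    have [-> _] := asE (b (a x + Q x)); rewrite addrC -ps.
    by have [-> _] := asE (a (b (a x + Q x))).
  rewrite XbE; have [<- _] := asE (a x + Q x).
  rewrite (opD _ _ bs) (opD _ _ ba); have [-> _] := asE (a x); have [-> _] := asE (Q x).
  by have [-> _] := pE x; have [_ ->] := pE x.
have am x : 2 *: a (m x) = a x + Q x.
  by rewrite -(opZ _ _ ba) two_m (opD _ _ ba) (aQE (w x)).1 addrC aw.
have Qm x : 2 *: Q (m x) = a x + Q x.
  by rewrite -(opZ _ _ bQ) two_m (opD _ _ bQ) (aQE (w x)).2 -aa aw.
(* [m] depends on its argument only through a + Q, and (a + Q) m = a + Q by the two preceding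
   identities. *)
have mm x : m (m x) = m x.
  rewrite [LHS]mE [RHS]mE /w; suff -> : a (m x) + Q (m x) = a x + Q x by [].
  have h := am x; rewrite -(Qm x) in h.
  have e : a (m x) = Q (m x).
    by apply: (scalerI (a := 2 : R[i])); rewrite ?pnatr_eq0.
  by rewrite -[RHS]am e scaler_nat mulr2n.
have bm : bounded_op m.
  have -> : m = (2^-1 : R[i]) *: ((a + Qs) \o s \o b \o (a + Q)).
    by apply/funext => x; rewrite mE.
  apply: bounded_scale; apply: bounded_comp; last exact: bounded_add.
  by apply: bounded_comp => //; apply: bounded_comp => //; exact: bounded_add.
have sb x : s (b x) = b (s x).
  have sX y : s (X y) = X (s y).
    rewrite /X !opE /= (opD _ _ bs); have [_ ->] := asE y.
    by have [-> _] := asE y.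
  by rewrite -[LHS]bXE -sX XbE.
have am' : adj m m.
  move=> x y; rewrite !mE.
  have h : (2^-1 : R[i])^*%C = 2^-1.
    by rewrite conjc_inv conjc_nat.
  rewrite cdotZl cdotZr h; congr (_ * _).
  have h1 : adj (a + Qs) (a + Q) by apply: adj_add => //; exact: adj_sym.
  have h2 : adj (a + Q) (a + Qs) by exact: adj_add.
  rewrite -[a (w x) + _]/((a + Qs) (w x)) h1 /w ads adjb sb.
  by rewrite -[a x + _]/((a + Q) x) h2.
have aJ x : a (2 *: m x - x) = Q x.
  by rewrite (opB _ _ ba) (opZ _ _ ba) am addrC addKr.
have QJ x : Q (2 *: m x - x) = a x.
  by rewrite (opB _ _ bQ) (opZ _ _ bQ) Qm addrK.
have adjJ x y : cdot (2 *: m x - x) y = cdot x (2 *: m y - y).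
  by rewrite cdotBl cdotZl am' cdotBr [in RHS]cdotZr (conjc_nat R 2).
split => //; split.
- move=> x; rewrite QJ; apply: cdot_injr => z.
  by rewrite -aQ -aJ adja adjJ.
- move=> x; rewrite /rdot adjJ -aJ -[complex.Re _]/(rdot _ _).
  by case: pa.
- move=> x Q0 Qs0; rewrite mE /w Q0 (opabs_ker Qs0) addr0.
  by rewrite (op0 bb) (op0 bs) (op0 ba) (op0 bQs) addr0 scaler0.
Qed.

End MatchedProjection.

(** * Block operators *)

Section HilbertSums.
Variables (R : realType).
Implicit Types (H K L : hilbertType R).

Lemma cdot_hsum H K (x y : hsum H K) : cdot x y = cdot x.1 y.1 + cdot x.2 y.2.
Proof. by []. Qed.

Lemma sqr_hnorm_hsum H K (x : hsum H K) : hnorm x ^+ 2 = hnorm x.1 ^+ 2 + hnorm x.2 ^+ 2.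
Proof. by rewrite !sqr_hnorm /rdot cdot_hsum raddfD. Qed.

Lemma hnorm_fst_le H K (x : hsum H K) : hnorm x.1 <= hnorm x.
Proof. by rewrite -ler_sqr ?nnegrE ?hnorm_ge0 // sqr_hnorm_hsum lerDl sqr_ge0. Qed.

Lemma hnorm_snd_le H K (x : hsum H K) : hnorm x.2 <= hnorm x.
Proof. by rewrite -ler_sqr ?nnegrE ?hnorm_ge0 // sqr_hnorm_hsum lerDr sqr_ge0. Qed.

Lemma hnorm_hsum_le H K (x : hsum H K) : hnorm x <= hnorm x.1 + hnorm x.2.
Proof.
rewrite -ler_sqr ?nnegrE ?addr_ge0 ?hnorm_ge0 // sqr_hnorm_hsum sqrrD addrAC lerDl.
by rewrite mulrn_wge0 // mulr_ge0 ?hnorm_ge0.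
Qed.

Definition hinl H K (x : H) : hsum H K := (x, 0).
Definition hinr H K (x : K) : hsum H K := (0, x).

Lemma adj_fst H K : adj (fst : hsum H K -> H) (@hinl H K).
Proof. by move=> x y; rewrite cdot_hsum /= cdot0r addr0. Qed.

Lemma adj_snd H K : adj (snd : hsum H K -> K) (@hinr H K).
Proof. by move=> x y; rewrite cdot_hsum /= cdot0r add0r. Qed.

Lemma opbound_fst H K : opbound (fst : hsum H K -> H) 1.
Proof. by move=> x; rewrite mul1r hnorm_fst_le. Qed.

Lemma opbound_snd H K : opbound (snd : hsum H K -> K) 1.
Proof. by move=> x; rewrite mul1r hnorm_snd_le. Qed.

Lemma opbound_inl H K : opbound (@hinl H K) 1.
Proof. by apply: adj_opbound (@adj_fst H K) ler01 (@opbound_fst H K). Qed.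

Lemma opbound_inr H K : opbound (@hinr H K) 1.
Proof. by apply: adj_opbound (@adj_snd H K) ler01 (@opbound_snd H K). Qed.

Lemma bounded_fst H K : bounded_op (fst : hsum H K -> H).
Proof. by apply/bounded_opP; split => //; exists 1 => //; exact: opbound_fst. Qed.

Lemma bounded_snd H K : bounded_op (snd : hsum H K -> K).
Proof. by apply/bounded_opP; split => //; exists 1 => //; exact: opbound_snd. Qed.

Lemma bounded_inl H K : bounded_op (@hinl H K).
Proof. exact: adj_bounded (@adj_fst H K) (bounded_fst H K). Qed.

Lemma bounded_inr H K : bounded_op (@hinr H K).
Proof. exact: adj_bounded (@adj_snd H K) (bounded_snd H K). Qed.

Section Blocks.
Variables (H1 H2 K1 K2 : hilbertType R).
Implicit Types (a : H1 -> K1) (b : H2 -> K1) (c : H1 -> K2) (d : H2 -> K2).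

Lemma op_diagE a d : op_diag a d = op_block a 0 0 d.
Proof. by apply/funext => x; rewrite /op_diag /op_block !opE addr0 add0r. Qed.

Lemma op_blockE a b c d : op_block a b c d =
  (@hinl K1 K2 \o a \o fst) + (@hinl K1 K2 \o b \o snd)
  + (@hinr K1 K2 \o c \o fst) + (@hinr K1 K2 \o d \o snd).
Proof.
apply/funext => x; rewrite !opE /op_block /hinl /hinr.
by rewrite [RHS]surjective_pairing /= !addr0 !add0r.
Qed.

Lemma bounded_block a b c d : bounded_op a -> bounded_op b -> bounded_op c ->
  bounded_op d -> bounded_op (op_block a b c d).
Proof.
move=> ba bb bc bd; rewrite op_blockE; have := bounded_fst H1 H2.
have := bounded_snd H1 H2; have := bounded_inl K1 K2; have := bounded_inr K1 K2.
move=> *; apply: bounded_add; [apply: bounded_add; [apply: bounded_add|]|].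
all: by apply: bounded_comp => //; exact: bounded_comp.
Qed.

Lemma block_ofE (X : hsum H1 H2 -> hsum K1 K2) : bounded_op X -> X =
  op_block (fst \o X \o @hinl H1 H2) (fst \o X \o @hinr H1 H2)
           (snd \o X \o @hinl H1 H2) (snd \o X \o @hinr H1 H2).
Proof.
move=> bX; apply/funext => x; rewrite /op_block /=.
have {1}-> : x = @hinl H1 H2 x.1 + @hinr H1 H2 x.2.
  by rewrite {1}[x]surjective_pairing /hinl /hinr; congr (_, _); rewrite ?addr0 ?add0r.
by rewrite (opD _ _ bX) [LHS]surjective_pairing.
Qed.

Lemma adj_block a b c d (a' : K1 -> H1) (b' : K1 -> H2) (c' : K2 -> H1) (d' : K2 -> H2) :
  adj a a' -> adj b b' -> adj c c' -> adj d d' ->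
  adj (op_block a b c d) (op_block a' c' b' d').
Proof.
move=> aa ab ac ad x y; rewrite !cdot_hsum /op_block /=.
by rewrite !cdotDl !cdotDr aa ab ac ad addrACA.
Qed.

Lemma add_block a b c d a' b' c' d' :
  op_block a b c d + op_block a' b' c' d' =
  op_block (a + a') (b + b') (c + c') (d + d').
Proof.
apply/funext => x; rewrite !opE /op_block !opE [LHS]surjective_pairing /=.
by congr (_, _); rewrite addrACA.
Qed.

Lemma scale_block (k : R[i]) a b c d :
  k *: op_block a b c d = op_block (k *: a) (k *: b) (k *: c) (k *: d).
Proof.
apply/funext => x; rewrite !opE /op_block !opE [LHS]surjective_pairing /=.
by congr (_, _); rewrite scalerDr.
Qed.

Lemma opp_block a b c d : - op_block a b c d = op_block (- a) (- b) (- c) (- d).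
Proof. by rewrite !opp_scale scale_block. Qed.

Lemma block0 : op_block (0 : H1 -> K1) (0 : H2 -> K1) 0 0 = 0 :> (_ -> hsum K1 K2).
Proof. by apply/funext => x; rewrite /op_block !opE !addr0. Qed.

Lemma opbound_sub_block (X : hsum H1 H2 -> hsum K1 K2) a b c d e :
  bounded_op a -> bounded_op b -> bounded_op c -> bounded_op d ->
  0 <= e -> opbound (X - op_block a b c d) e ->
  [/\ opbound ((fst \o X \o @hinl H1 H2) - a) e, opbound ((fst \o X \o @hinr H1 H2) - b) e,
      opbound ((snd \o X \o @hinl H1 H2) - c) e & opbound ((snd \o X \o @hinr H1 H2) - d) e].
Proof.
move=> ba bb bc bd e0 Xe.
have hl x : hnorm ((X - op_block a b c d) (x, 0)) <= e * hnorm x.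
  apply: le_trans (Xe _) _; rewrite ler_wpM2l // -[leRHS]mul1r; exact: opbound_inl.
have hr x : hnorm ((X - op_block a b c d) (0, x)) <= e * hnorm x.
  apply: le_trans (Xe _) _; rewrite ler_wpM2l // -[leRHS]mul1r; exact: opbound_inr.
split=> x; [have := hl x|have := hr x|have := hl x|have := hr x];
  apply: le_trans.
- have -> : ((fst \o X \o @hinl H1 H2) - a) x = ((X - op_block a b c d) (x, 0)).1.
    by rewrite !opE /op_block /= (op0 bb) addr0.
  exact: hnorm_fst_le.
- have -> : ((fst \o X \o @hinr H1 H2) - b) x = ((X - op_block a b c d) (0, x)).1.
    by rewrite !opE /op_block /= (op0 ba) add0r.
  exact: hnorm_fst_le.
- have -> : ((snd \o X \o @hinl H1 H2) - c) x = ((X - op_block a b c d) (x, 0)).2.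
    by rewrite !opE /op_block /= (op0 bd) addr0.
  exact: hnorm_snd_le.
- have -> : ((snd \o X \o @hinr H1 H2) - d) x = ((X - op_block a b c d) (0, x)).2.
    by rewrite !opE /op_block /= (op0 bc) add0r.
  exact: hnorm_snd_le.
Qed.

End Blocks.

Lemma comp_block H1 H2 K1 K2 L1 L2 (a : K1 -> L1) (b : K2 -> L1) (c : K1 -> L2)
    (d : K2 -> L2) (a' : H1 -> K1) (b' : H2 -> K1) (c' : H1 -> K2) (d' : H2 -> K2) :
  bounded_op a -> bounded_op b -> bounded_op c -> bounded_op d ->
  op_block a b c d \o op_block a' b' c' d' =
  op_block ((a \o a') + (b \o c')) ((a \o b') + (b \o d'))
           ((c \o a') + (d \o c')) ((c \o b') + (d \o d')).
Proof.
move=> ba bb bc bd; apply/funext => x; rewrite /op_block /= !opE.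
rewrite (opD _ _ ba) (opD _ _ bb) (opD _ _ bc) (opD _ _ bd).
by congr (_, _); rewrite addrACA.
Qed.

Lemma comp0f H K L (T : H -> K) : (0 : K -> L) \o T = 0.
Proof. by apply/funext. Qed.

Lemma diag_split H1 H2 K1 K2 (a : H1 -> K1) (d : H2 -> K2) :
  op_diag a d = op_diag a 0 + op_diag 0 d.
Proof. by rewrite !op_diagE add_block !addr0 add0r. Qed.

Lemma sub_diagl H1 H2 K1 K2 (a : H1 -> K1) (d d' : H2 -> K2) :
  op_diag a d - op_diag a d' = op_diag 0 (d - d').
Proof. by rewrite !op_diagE opp_block add_block !subrr. Qed.

Lemma diag_id H K : op_diag (idfun : H -> H) (idfun : K -> K) = idfun.
Proof. by apply/funext => x; rewrite /op_diag -surjective_pairing. Qed.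

Lemma bounded_diag H1 H2 K1 K2 (a : H1 -> K1) (d : H2 -> K2) :
  bounded_op a -> bounded_op d -> bounded_op (op_diag a d).
Proof.
by move=> ba bd; rewrite op_diagE; apply: bounded_block => //; exact: bounded0.
Qed.

Lemma adj_diag H1 H2 K1 K2 (a : H1 -> K1) (d : H2 -> K2) a' d' :
  adj a a' -> adj d d' -> adj (op_diag a d) (op_diag a' d').
Proof.
by move=> ba bd; rewrite !op_diagE; apply: adj_block => //; exact: adj0.
Qed.

End HilbertSums.

(** * The canonical decomposition *)

Section CanonicalDecomposition.
Variables (R : realType) (H : hilbertType R) (Q : H -> H).
Variables (H1 H4 H5 H6 : closedSubspace H) (U : H5 -> H6) (D : H5 -> H5).
Hypotheses (bQ : bounded_op Q) (QQ : forall x, Q (Q x) = Q x).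
Hypothesis QUD : canonical_decomposition Q H1 H4 U D.

Local Notation m := (matched_projection Q).
Local Notation W := (canonical_map H1 H4 H5 H6).

Let bm : bounded_op m. Proof. by case: (matched_projectionP bQ QQ). Qed.
Let am : adj m m. Proof. by case: (matched_projectionP bQ QQ). Qed.
Let mm x : m (m x) = m x. Proof. by case: (matched_projectionP bQ QQ) => _ _ ->. Qed.
Let QsE x : adjoint Q x = 2 *: m (Q (2 *: m x - x)) - Q (2 *: m x - x).
Proof. by case: (matched_projectionP bQ QQ) => _ _ _ [->]. Qed.
Let JQ_ge0 x : 0 <= rdot (2 *: m (Q x) - Q x) x.
Proof. by case: (matched_projectionP bQ QQ) => _ _ _ [_ ->]. Qed.
Let m_ker x : Q x = 0 -> adjoint Q x = 0 -> m x = 0.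
Proof. by case: (matched_projectionP bQ QQ) => _ _ _ [_ _]; exact. Qed.
Let aQ : adj Q (adjoint Q). Proof. exact: adjointP. Qed.

Lemma closure_orth (S : set H) x :
  (forall z, S z -> cdot x z = 0) -> forall z, closure S z -> cdot x z = 0.
Proof.
move=> h z /closure_hnormP cz; apply/eqP; rewrite -normr_eq0.
have -> : `|cdot x z| = (complex.Re `|cdot x z|)%:C%C by rewrite RRe_real ?ger0_real.
suff h0 : complex.Re `|cdot x z| <= 0.
  rewrite (_ : complex.Re _ = 0) //; apply/eqP.
  by rewrite eq_le h0 -ler0c RRe_real ?ger0_real /=.
apply/ler_addgt0Pr => e e0; rewrite add0r.
have c1 : 0 < hnorm x + 1 by rewrite ltr_wpDl ?hnorm_ge0.
have [y Sy zy] := cz _ (divr_gt0 e0 c1).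
have -> : cdot x z = cdot x (z - y) by rewrite cdotBr (h _ Sy) subr0.
apply: le_trans (normc_dot_CS _ _) _.
by move: zy; rewrite ltr_pdivlMr // => zy; have := hnorm_ge0 (z - y); nra.
Qed.

Let dbl (v : H) : (2 : R[i]) *: v - v = v.
Proof. by rewrite scaler_nat mulr2n addrK. Qed.

Let H1P x : subspace_set H1 x -> m x = x /\ Q x = x.
Proof.
rewrite (canonical_H1 QUD) => -[[y _ yx] [z _ zx]].
by split; [rewrite -yx mm | rewrite -zx QQ].
Qed.

Let H1I x : m x = x -> Q x = x -> subspace_set H1 x.
Proof. by move=> mx Qx; rewrite (canonical_H1 QUD); split; exists x. Qed.

Let H4P x : subspace_set H4 x -> m x = 0 /\ Q x = 0.
Proof. by rewrite (canonical_H4 QUD). Qed.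

Let H4I x : m x = 0 -> Q x = 0 -> subspace_set H4 x.
Proof. by rewrite (canonical_H4 QUD). Qed.

Let H5m y : subspace_set H5 (m (Q (y - m y))).
Proof. by rewrite (canonical_H5 QUD); apply: subset_closure; exists y. Qed.

Let H6m y : subspace_set H6 (Q (m y) - m (Q (m y))).
Proof. by rewrite (canonical_H6 QUD); apply: subset_closure; exists y. Qed.

Let H5orth x : (forall y, cdot x (m (Q (y - m y))) = 0) ->
  forall z, subspace_set H5 z -> cdot x z = 0.
Proof.
by rewrite (canonical_H5 QUD) => h; apply: closure_orth => _ [y _ <-]; exact: h.
Qed.

Let H6orth x : (forall y, cdot x (Q (m y) - m (Q (m y))) = 0) ->
  forall z, subspace_set H6 z -> cdot x z = 0.
Proof.
by rewrite (canonical_H6 QUD) => h; apply: closure_orth => _ [y _ <-]; exact: h.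
Qed.

Let H5P x : subspace_set H5 x -> m x = x.
Proof.
move=> h; apply/eqP; rewrite -subr_eq0; apply/eqP/cdot_eq0 => z.
rewrite cdotBl am -cdotBr cdotC; apply/eqP; rewrite conjc_eq0; apply/eqP.
apply: H5orth h => y.
by rewrite -am (opB _ _ bm) mm subrr cdot0l.
Qed.

Let H6P x : subspace_set H6 x -> m x = 0.
Proof.
move=> h; apply/cdot_eq0 => z.
rewrite am cdotC; apply/eqP; rewrite conjc_eq0; apply/eqP.
apply: H6orth h => y.
by rewrite am (opB _ _ bm) mm subrr cdot0r.
Qed.

Let orth_range x y : m x = x -> m y = 0 -> cdot x y = 0.
Proof. by move=> <- my; rewrite am my cdot0r. Qed.

(** As Q^* = J Q J, a vector x of [H1] is fixed by the adjoint too, so <x, m Q (1 - m) y> = <x, (1 -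
    m) y> = 0. *)
Let orth15 x y : subspace_set H1 x -> subspace_set H5 y -> cdot x y = 0.
Proof.
move=> /H1P[mx Qx]; apply: H5orth => {}y.
have Qsx : adjoint Q x = x.
  by rewrite QsE mx dbl Qx mx dbl.
by rewrite -am mx -(adj_sym aQ) Qsx cdotBr -am mx subrr.
Qed.

Let orth46 x y : subspace_set H4 x -> subspace_set H6 y -> cdot x y = 0.
Proof.
move=> /H4P[mx Qx]; apply: H6orth => {}y.
have Qsx : adjoint Q x = 0.
  by rewrite QsE mx scaler0 add0r (opN _ bQ) Qx oppr0 (op0 bm) scaler0 subrr.
by rewrite cdotBr -am mx cdot0l subr0 -(adj_sym aQ) Qsx cdot0l.
Qed.

(** Orthogonality to [H5] says that Q^* x lies in the range of m; since Q^* x = J Q x here, so does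
    Q x, and both agree. Then x - Q x is in the range of m and is killed by Q and its adjoint, hence
    is 0 by [m_ker]. So x lies in [H1], to which it is orthogonal. *)
Let range_total x : m x = x -> (forall z, subspace_set H1 z -> cdot x z = 0) ->
  (forall z, subspace_set H5 z -> cdot x z = 0) -> x = 0.
Proof.
move=> mx o1 o5.
have mQx : m (Q x) = Q x.
  have h : adjoint Q x = m (adjoint Q x).
    apply/eqP; rewrite -subr_eq0; apply/eqP/cdot_eq0 => z.
    by rewrite cdotBl am -cdotBr (adj_sym aQ) -{1}mx am o5.
  rewrite QsE mx dbl (opB _ _ bm) (opZ _ _ bm) mm in h.
  apply/eqP; rewrite -subr_eq0; apply/eqP.
  have -> : m (Q x) - Q x = (2 *: m (Q x) - Q x) - (2 *: m (Q x) - m (Q x)) by vec.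
  by rewrite h subrr.
have Qsx : adjoint Q x = Q x by rewrite QsE mx dbl mQx dbl.
have v0 : x - Q x = 0.
  have mv : m (x - Q x) = x - Q x by rewrite (opB _ _ bm) mx mQx.
  rewrite -mv; apply: m_ker; first by rewrite (opB _ _ bQ) QQ subrr.
  rewrite QsE mv dbl (opB _ _ bQ) QQ subrr.
  by rewrite (op0 bm) scaler0 subrr.
have Qx : Q x = x by apply/eqP; rewrite eq_sym -subr_eq0 v0.
by apply: hnorm_eq0; apply/eqP; rewrite -sqrf_eq0 sqr_hnorm /rdot o1 //; exact: H1I.
Qed.

(** Orthogonality to [H6] gives m Q x = 0, so J Q x = - Q x. Positivity of J Q at the vector Q x
    then reads - ||Q x||^2 >= 0, which puts x in [H4]. *)
Let null_total x : m x = 0 -> (forall z, subspace_set H4 z -> cdot x z = 0) ->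
  (forall z, subspace_set H6 z -> cdot x z = 0) -> x = 0.
Proof.
move=> mx o4 o6.
have QsE' : adjoint Q x = Q x - 2 *: m (Q x).
  by rewrite QsE mx scaler0 add0r (opN _ bQ) (opN _ bm); vec.
have mQx : m (Q x) = 0.
  have h : m (adjoint Q x) = 0.
    apply/cdot_eq0 => z; rewrite am (adj_sym aQ).
    have := o6 _ (H6m z); rewrite cdotBr => /eqP; rewrite subr_eq0 => /eqP ->.
    by rewrite -am mx cdot0l.
  move: h; rewrite QsE' (opB _ _ bm) (opZ _ _ bm) mm => h.
  by have -> : m (Q x) = - (m (Q x) - 2 *: m (Q x)); [vec | rewrite h oppr0].
have Qx : Q x = 0.
  have := JQ_ge0 (Q x).
  rewrite QQ mQx scaler0 add0r rdotNl -sqr_hnorm oppr_ge0 => h.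
  by apply: hnorm_eq0; apply/eqP; rewrite -sqrf_eq0 eq_le h sqr_ge0.
by apply: hnorm_eq0; apply/eqP; rewrite -sqrf_eq0 sqr_hnorm /rdot o4 //; exact: H4I.
Qed.

Definition canonical_map_inv (v : hsum (hsum H1 H4) (hsum H5 H6)) : H :=
  (emb v.1.1 + emb v.1.2) + (emb v.2.1 + emb v.2.2).
Local Notation W' := canonical_map_inv.

Lemma canonical_map_adj : adj W W'.
Proof.
move=> x v; rewrite !cdot_hsum /= !orthproj_adj /canonical_map_inv.
by rewrite !cdotDr.
Qed.

Lemma bounded_canonical_map : bounded_op W.
Proof.
apply: (adj_bounded (adj_sym canonical_map_adj)).
apply/bounded_opP; split; first exact: adj_linear canonical_map_adj.
exists 4 => // v; rewrite /canonical_map_inv.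
have h11 := hnorm_fst_le v.1; have h12 := hnorm_snd_le v.1.
have h21 := hnorm_fst_le v.2; have h22 := hnorm_snd_le v.2.
have h1 := hnorm_fst_le v; have h2 := hnorm_snd_le v.
have := hnormD (emb v.1.1 + emb v.1.2) (emb v.2.1 + emb v.2.2).
have := hnormD (emb v.1.1) (emb v.1.2); have := hnormD (emb v.2.1) (emb v.2.2).
rewrite !hnorm_emb; lra.
Qed.

Let flip (M N : closedSubspace H) :
  (forall x y, subspace_set M x -> subspace_set N y -> cdot x y = 0) ->
  forall x y, subspace_set N x -> subspace_set M y -> cdot x y = 0.
Proof. by move=> h x y Nx My; rewrite cdotC h // conjc0. Qed.

Let proj0 (M N : closedSubspace H) (y : M) :
  (forall x y, subspace_set M x -> subspace_set N y -> cdot x y = 0) ->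
  orthproj N (emb y) = 0.
Proof.
move=> h; apply: cdot_eq0 => z; rewrite orthproj_adj.
by apply: h; exact: embP.
Qed.

Let o14 x y : subspace_set H1 x -> subspace_set H4 y -> cdot x y = 0.
Proof. by move=> /H1P[mx _] /H4P[my _]; exact: orth_range. Qed.
Let o16 x y : subspace_set H1 x -> subspace_set H6 y -> cdot x y = 0.
Proof. by move=> /H1P[mx _] /H6P my; exact: orth_range. Qed.
Let o54 x y : subspace_set H5 x -> subspace_set H4 y -> cdot x y = 0.
Proof. by move=> /H5P mx /H4P[my _]; exact: orth_range. Qed.
Let o56 x y : subspace_set H5 x -> subspace_set H6 y -> cdot x y = 0.
Proof. by move=> /H5P mx /H6P my; exact: orth_range. Qed.

Lemma canonical_mapK' : W \o W' = idfun.
Proof.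
apply/funext => -[[v1 v4] [v5 v6]].
have lD (M : closedSubspace H) (x y : H) :
    orthproj M (x + y) = orthproj M x + orthproj M y.
  by have := orthproj_linear M 1 x y; rewrite !scale1r.
rewrite /= /canonical_map /canonical_map_inv /= !lD !orthproj_emb.
rewrite (proj0 _ (flip o14)) (proj0 _ (flip orth15)) (proj0 _ (flip o16)).
rewrite (proj0 _ o14) (proj0 _ o54) (proj0 _ (flip orth46)).
rewrite (proj0 _ orth15) (proj0 _ (flip o54)) (proj0 _ (flip o56)).
rewrite (proj0 _ o16) (proj0 _ orth46) (proj0 _ o56).
by rewrite !addr0 !add0r.
Qed.

(** Here the four spaces must exhaust [H]: the residue y is orthogonal to all of them, so
    [range_total] kills m y, and then [null_total] kills y. *)
Lemma canonical_mapK : W' \o W = idfun.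
Proof.
apply/funext => x; apply/eqP; rewrite /= eq_sym -subr_eq0; apply/eqP.
set y := x - _; have Wy : W y = 0.
  have bW := bounded_canonical_map.
  rewrite (opB _ _ bW); apply/eqP; rewrite subr_eq0; apply/eqP/esym.
  by rewrite -[LHS]/((W \o W') (W x)) canonical_mapK'.
have yo (M : closedSubspace H) : orthproj M y = 0 ->
    forall z, subspace_set M z -> cdot y z = 0.
  by move=> h z /emb_surj[z' <-]; rewrite -orthproj_adj h cdot0l.
move: Wy => /pair_equal_spec[/pair_equal_spec[/yo y1 /yo y4] /pair_equal_spec[/yo y5 /yo y6]].
have my : m y = 0.
  apply: range_total => // z hz; rewrite am.
    by have [-> _] := H1P hz; exact: y1.
  by rewrite (H5P hz); exact: y5.
exact: null_total.
Qed.

Lemma canonical_unitaryP :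
  let V := canonical_unitary H1 H4 U in let V' := adjoint V in
  [/\ bounded_op V, adj V V', V \o V' = idfun, V' \o V = idfun &
   V \o Q \o V' = op_diag (op_diag idfun 0)
     (op_block D (- ell D) (ell D) (idfun - D))].
Proof.
have [bU U'U UU'] := canonical_U QUD.
have aU := adjointP bU.
have UUE x : adjoint U (U x) = x by rewrite -[LHS]/((adjoint U \o U) x) U'U.
have UUE' x : U (adjoint U x) = x by rewrite -[LHS]/((U \o adjoint U) x) UU'.
pose G : hsum (hsum H1 H4) (hsum H5 H6) -> hsum (hsum H1 H4) (hsum H5 H5) :=
  op_diag (op_diag idfun idfun) (op_diag idfun (adjoint U)).
pose G' : hsum (hsum H1 H4) (hsum H5 H5) -> hsum (hsum H1 H4) (hsum H5 H6) :=
  op_diag (op_diag idfun idfun) (op_diag idfun U).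
have aG : adj G G' by apply: adj_diag; apply: adj_diag => //; exact: adj_sym.
have bG : bounded_op G.
  by apply: bounded_diag; apply: bounded_diag; (exact: bounded_id || exact: bounded_adjoint).
have bV : bounded_op (G \o W) := bounded_comp bG bounded_canonical_map.
have aV : adj (G \o W) (W' \o G') := adj_comp aG canonical_map_adj.
have aW : adjoint W = W' := adj_adjoint canonical_map_adj.
rewrite /canonical_unitary -/G (adj_adjoint aV) /=; split => //.
- rewrite -compA (compA W) canonical_mapK'; apply/funext => -[[v1 v4] [v5 v6]].
  by rewrite /G /G' /op_diag /= UUE.
- rewrite -compA (compA G'); have -> : G' \o G = idfun.
    by apply/funext => -[[v1 v4] [v5 v6]]; rewrite /G /G' /op_diag /= UUE'.
  exact: canonical_mapK.
have := canonical_Q QUD; rewrite /= aW => h.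
have -> : G \o W \o Q \o (W' \o G') = G \o (W \o Q \o W') \o G' by [].
have bU' := bounded_adjoint bU.
rewrite h; apply/funext => -[[v1 v4] [v5 v6]].
rewrite /G /G' /op_diag /op_block /= !opE /=.
congr (_, (_, _)); first by rewrite UUE.
by rewrite !UUE (opD _ _ bU') !UUE.
Qed.

End CanonicalDecomposition.

(** * Constructions of C*-subalgebras *)

(** Contractivity is included because it makes preimages norm closed. Units need not be preserved,
    so that corner embeddings qualify. *)
Record star_hom (R : realType) (H K : hilbertType R) (phi : (K -> K) -> H -> H) :
    Prop := {
  star_bounded : forall T, bounded_op T -> bounded_op (phi T) ;
  star0 : phi 0 = 0 ;
  starD : forall S T, bounded_op S -> bounded_op T -> phi (S + T) = phi S + phi T ;
  starZ : forall (a : R[i]) T, bounded_op T -> phi (a *: T) = a *: phi T ;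
  starM : forall S T, bounded_op S -> bounded_op T -> phi (S \o T) = phi S \o phi T ;
  starA : forall S T, adj S T -> adj (phi S) (phi T) ;
  star_opbound : forall T c, 0 <= c -> opbound T c -> opbound (phi T) c
}.

Section Constructions.
Variable R : realType.
Implicit Types (H K : hilbertType R).

Lemma Cstar_pullback H K (phi : (K -> K) -> H -> H) (A : set (H -> H)) :
  star_hom phi -> Cstar_subalgebra A ->
  Cstar_subalgebra [set T | bounded_op T /\ A (phi T)].
Proof.
move=> sp CA; apply: Build_Cstar_opbound => /=.
- by move=> T [].
- by rewrite (star0 sp); split; [exact: bounded0 | exact: Cstar_zero].
- move=> S T [bS AS] [bT AT]; split; first exact: bounded_add.
  by rewrite (starD sp) //; exact: Cstar_add.
- move=> a T [bT AT]; split; first exact: bounded_scale.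
  by rewrite (starZ sp) //; exact: Cstar_scale.
- move=> S T [bS AS] [bT AT]; split; first exact: bounded_comp.
  by rewrite (starM sp) //; exact: Cstar_comp.
- move=> T [bT AT]; split; first exact: bounded_adjoint.
  by rewrite -(adj_adjoint (starA sp (adjointP bT))); exact: Cstar_adjoint.
- move=> T bT h; split => //; apply: (Cstar_closed_opbound CA) => [|e e0].
    exact: star_bounded.
  have [S [bS AS] TS] := h e e0; exists (phi S) => //.
  have -> : phi T - phi S = phi (T - S).
    by rewrite !opp_scale -(starZ sp) // -(starD sp) //; exact: bounded_scale.
  by apply: star_opbound TS => //; exact: ltW.
Qed.

Lemma star_hom_conj H K (V : H -> K) (V' : K -> H) :
  bounded_op V -> adj V V' -> V \o V' = idfun -> V' \o V = idfun ->
  star_hom (fun T : K -> K => V' \o T \o V).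
Proof.
move=> bV aV VV' V'V; have bV' := adj_bounded aV bV.
have iso x : hnorm (V x) = hnorm x.
  apply/eqP; rewrite -(@eqrXn2 _ 2) ?hnorm_ge0 // !sqr_hnorm (adj_rdot _ _ aV).
  by rewrite -[V' (V x)]/((V' \o V) x) V'V.
have iso' x : hnorm (V' x) = hnorm x.
  by rewrite -iso -[V (V' x)]/((V \o V') x) VV'.
split.
- by move=> T bT; apply: bounded_comp => //; exact: bounded_comp.
- by apply/funext => x; rewrite /= !opE (op0 bV').
- by move=> S T _ _; apply/funext => x; rewrite /= !opE /= (opD _ _ bV').
- by move=> a T _; apply/funext => x; rewrite /= !opE /= (opZ _ _ bV').
- move=> S T _ _; apply/funext => x /=.
  by rewrite -[V (V' _)]/((V \o V') _) VV'.
- by move=> S T aS x y; rewrite /= (adj_sym aV) aS aV.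
- by move=> T c c0 Tc x; rewrite /= iso' -(iso x).
Qed.

Lemma star_hom_diagr H K :
  star_hom (fun T : K -> K => op_diag (0 : H -> H) T).
Proof.
split.
- by move=> T bT; apply: bounded_diag => //; exact: bounded0.
- by rewrite op_diagE block0.
- by move=> S T _ _; rewrite !op_diagE add_block !addr0.
- by move=> a T _; rewrite !op_diagE scale_block !scaler0.
- by [].
- by move=> S T aS; apply: adj_diag => //; exact: adj0.
- move=> T c c0 Tc x; apply: le_trans (hnorm_hsum_le _) _.
  rewrite /op_diag /= opE hnorm0 add0r; apply: le_trans (Tc _) _.
  by rewrite ler_wpM2l // hnorm_snd_le.
Qed.

Lemma star_hom_diagl H K :
  star_hom (fun T : K -> K => op_diag T (0 : H -> H)).
Proof.
split.
- by move=> T bT; apply: bounded_diag => //; exact: bounded0.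
- by rewrite op_diagE block0.
- by move=> S T _ _; rewrite !op_diagE add_block !addr0.
- by move=> a T _; rewrite !op_diagE scale_block !scaler0.
- by [].
- by move=> S T aS; apply: adj_diag => //; exact: adj0.
- move=> T c c0 Tc x; apply: le_trans (hnorm_hsum_le _) _.
  rewrite /op_diag /= opE hnorm0 addr0; apply: le_trans (Tc _) _.
  by rewrite ler_wpM2l // hnorm_fst_le.
Qed.

Lemma opbound_all0 H K (T : H -> K) : (forall e, 0 < e -> opbound T e) -> T = 0.
Proof.
move=> h; apply: (@opbound_small0 _ _ _ _ (fun n => 1 * n.+1%:R^-1)).
  by move=> eps; exact: harmonic_small.
by move=> n; rewrite mul1r; apply: h; rewrite invr_gt0.
Qed.

Lemma Cstar_zero_set H : Cstar_subalgebra [set 0 : H -> H].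
Proof.
apply: Build_Cstar_opbound => /=.
- by move=> T ->; exact: bounded0.
- by [].
- by move=> S T -> ->; rewrite addr0.
- by move=> a T ->; rewrite scaler0.
- by move=> S T -> ->; rewrite comp0f.
- by move=> T ->; rewrite (adj_adjoint (@adj0 _ _ _)).
- by move=> T bT h; apply: opbound_all0 => e /h[S ->]; rewrite subr0.
Qed.

(** For closedness, the scalar of a limit [T] is recovered as <T u, u> at a unit vector. There is
    none in the zero space, a possible value of [H1], which is treated apart. *)
Lemma Cstar_scalars H :
  Cstar_subalgebra [set T : H -> H | exists a : R[i], T = a *: idfun].
Proof.
apply: Build_Cstar_opbound => /=.
- by move=> T [a ->]; apply/bounded_scale/bounded_id.
- by exists 0; rewrite scale0r.
- by move=> S T [a ->] [b ->]; exists (a + b); rewrite scalerDl.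
- by move=> c T [a ->]; exists (c * a); rewrite scalerA.
- move=> S T [a ->] [b ->]; exists (a * b).
  by apply/funext => x; rewrite /= !opE /= scalerA.
- move=> T [a ->]; exists a^*%C.
  by apply: adj_adjoint; apply: adj_scale; exact: adj_id.
move=> T bT h; have [[x0 x0n]|triv] := pselect (exists x : H, x != 0); last first.
  exists 0; apply/funext => x; have -> : x = 0.
    by apply/eqP/negPn/negP => xn; apply: triv; exists x.
  by rewrite (op0 bT) opE scale0r.
have hx0 : 0 < hnorm x0.
  by rewrite lt0r hnorm_ge0 andbT; apply: contraNneq x0n => /hnorm_eq0 ->.
pose u := (hnorm x0)^-1%:C%C *: x0.
have u1 : hnorm u = 1 by rewrite hnormZr ger0_norm ?invr_ge0 ?hnorm_ge0 // mulVf ?gt_eqF.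
pose a := cdot (T u) u; exists a; apply/eqP; rewrite -subr_eq0; apply/eqP.
apply: opbound_all0 => e e0; have e2 : 0 < e / 2 by rewrite divr_gt0.
have [_ [b ->] Tb] := h _ e2; move=> x.
have -> : (T - a *: idfun) x = (T - b *: idfun) x - (a - b) *: x.
  by rewrite !opE /=; vec.
apply: le_trans (hnormB _ _) _; rewrite [e in leRHS]splitr mulrDl lerD //.
rewrite hnormZ ler_wpM2r ?hnorm_ge0 //.
have -> : a - b = cdot ((T - b *: idfun) u) u.
  by rewrite !opE /= cdotBl cdotZl cdot_self u1 expr1n mulr1.
apply: le_trans (normc_dot_CS _ _) _; rewrite u1 mulr1.
by apply: le_trans (Tb _) _; rewrite u1 mulr1.
Qed.

Lemma Cstar_diag H K (A : set (H -> H)) (B : set (K -> K)) :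
  Cstar_subalgebra A -> Cstar_subalgebra B ->
  Cstar_subalgebra [set X | exists S T, [/\ A S, B T & X = op_diag S T]].
Proof.
move=> CA CB; apply: Build_Cstar_opbound => /=.
- move=> _ [S [T [AS BT ->]]].
  by apply: bounded_diag; [exact: (Cstar_bounded CA) | exact: (Cstar_bounded CB)].
- exists 0, 0; split; [exact: (Cstar_zero CA) | exact: (Cstar_zero CB)|].
  by rewrite op_diagE block0.
- move=> _ _ [S [T [AS BT ->]]] [S' [T' [AS' BT' ->]]]; exists (S + S'), (T + T').
  split; [exact: (Cstar_add CA) | exact: (Cstar_add CB) |].
  by rewrite !op_diagE add_block !addr0.
- move=> a _ [S [T [AS BT ->]]]; exists (a *: S), (a *: T).
  split; [exact: (Cstar_scale CA) | exact: (Cstar_scale CB) |].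
  by rewrite !op_diagE scale_block !scaler0.
- move=> _ _ [S [T [AS BT ->]]] [S' [T' [AS' BT' ->]]]; exists (S \o S'), (T \o T').
  by split; [exact: (Cstar_comp CA) | exact: (Cstar_comp CB) |].
- move=> _ [S [T [AS BT ->]]]; exists (adjoint S), (adjoint T).
  split; [exact: (Cstar_adjoint CA) | exact: (Cstar_adjoint CB) |].
  apply: adj_adjoint; apply: adj_diag; apply: adjointP.
    exact: (Cstar_bounded CA).
  exact: (Cstar_bounded CB).
(* Corners are obtained by compression with contractions, so each corner of a limit is approximated
   by the corresponding corners; the off-diagonal ones are limits of 0. *)
move=> X bX h; have b0 := @bounded0 R.
have h' e : 0 < e -> exists S T, [/\ A S, B T,
    [/\ opbound ((fst \o X \o @hinl R H K) - S) e & opbound ((snd \o X \o @hinr R H K) - T) e] &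
    [/\ opbound (fst \o X \o @hinr R H K) e & opbound (snd \o X \o @hinl R H K) e]].
  move=> e0; have [_ [S [T [AS BT ->]]]] := h e e0.
  rewrite op_diagE => XST; exists S, T.
  have [] := opbound_sub_block (Cstar_bounded CA AS) (b0 _ _) (b0 _ _)
    (Cstar_bounded CB BT) (ltW e0) XST.
  by rewrite !subr0.
exists (fst \o X \o @hinl R H K), (snd \o X \o @hinr R H K); split.
- apply: (Cstar_closed_opbound CA) => [|e /h'[S [T [AS _ [XS _] _]]]]; last by exists S.
  by apply: bounded_comp3; [exact: bounded_fst | exact: bX | exact: bounded_inl].
- apply: (Cstar_closed_opbound CB) => [|e /h'[S [T [_ BT [_ XT] _]]]]; last by exists T.
  by apply: bounded_comp3; [exact: bounded_snd | exact: bX | exact: bounded_inr].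
rewrite {1}(block_ofE bX) op_diagE; congr op_block.
- by apply: opbound_all0 => e /h'[S [T [_ _ _ []]]].
- by apply: opbound_all0 => e /h'[S [T [_ _ _ []]]].
Qed.

Lemma Cstar_matrix2 H (A : set (H -> H)) :
  Cstar_subalgebra A -> Cstar_subalgebra (matrix2 A).
Proof.
move=> CA; have bA := Cstar_bounded CA; apply: Build_Cstar_opbound.
- by move=> _ [a [b [c [d [[Aa Ab Ac Ad] ->]]]]]; apply: bounded_block; exact: bA.
- by exists 0, 0, 0, 0; rewrite block0; split => //; split; exact: (Cstar_zero CA).
- move=> _ _ [a [b [c [d [[Aa Ab Ac Ad] ->]]]]] [a' [b' [c' [d' [[? ? ? ?] ->]]]]].
  exists (a + a'), (b + b'), (c + c'), (d + d'); rewrite add_block; split=> //.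
  by split; exact: (Cstar_add CA).
- move=> k _ [a [b [c [d [[Aa Ab Ac Ad] ->]]]]].
  exists (k *: a), (k *: b), (k *: c), (k *: d); rewrite scale_block; split=> //.
  by split; exact: (Cstar_scale CA).
- move=> _ _ [a [b [c [d [[Aa Ab Ac Ad] ->]]]]] [a' [b' [c' [d' [[? ? ? ?] ->]]]]].
  rewrite comp_block; try exact: bA; do 4!eexists; split; last reflexivity.
  by split; apply: (Cstar_add CA); exact: (Cstar_comp CA).
- move=> _ [a [b [c [d [[Aa Ab Ac Ad] ->]]]]].
  exists (adjoint a), (adjoint c), (adjoint b), (adjoint d); split.
    by split; exact: (Cstar_adjoint CA).
  by apply: adj_adjoint; apply: adj_block; apply: adjointP; exact: bA.
move=> X bX h; have h' e : 0 < e -> exists a b c d, [/\ A a, A b, A c & A d] /\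
    [/\ opbound ((fst \o X \o @hinl R H H) - a) e, opbound ((fst \o X \o @hinr R H H) - b) e,
        opbound ((snd \o X \o @hinl R H H) - c) e & opbound ((snd \o X \o @hinr R H H) - d) e].
  move=> e0; have [_ [a [b [c [d [[Aa Ab Ac Ad] ->]]]]] Xe] := h e e0.
  exists a, b, c, d; split => //.
  by apply: opbound_sub_block Xe; (exact: ltW || exact: bA).
do 4!eexists; split; last exact: (block_ofE bX).
split; apply: (Cstar_closed_opbound CA).
- by apply: bounded_comp3; [exact: bounded_fst | exact: bX | exact: bounded_inl].
- by move=> e /h'[a [b [c [d [[]]]]]] ? ? ? ? [? ? ? ?]; exists a.
- by apply: bounded_comp3; [exact: bounded_fst | exact: bX | exact: bounded_inr].
- by move=> e /h'[a [b [c [d [[]]]]]] ? ? ? ? [? ? ? ?]; exists b.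
- by apply: bounded_comp3; [exact: bounded_snd | exact: bX | exact: bounded_inl].
- by move=> e /h'[a [b [c [d [[]]]]]] ? ? ? ? [? ? ? ?]; exists c.
- by apply: bounded_comp3; [exact: bounded_snd | exact: bX | exact: bounded_inr].
- by move=> e /h'[a [b [c [d [[]]]]]] ? ? ? ? [? ? ? ?]; exists d.
Qed.

End Constructions.

(** * The C*-algebra generated by Q *)

(** The inverse gives ||x|| <= s ||T x||, and [pos_sqr] gives ||T x||^2 <= M <T x, x>, whence the
    constant 1 / (M s^2). *)
Lemma pos_invertible_coercive (R : realType) (H : hilbertType R) (T S : H -> H) :
  pos_op T -> is_op_inverse T S ->
  exists2 d : R, 0 < d & forall x, d * hnorm x ^+ 2 <= rdot (T x) x.
Proof.
move=> pT [bS ST _]; have [bT aT hT] := pT.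
have [_ [M0 M00 TM0]] := (bounded_opP T).1 bT.
have [_ [s0 s00 Ss0]] := (bounded_opP S).1 bS.
pose M := M0 + 1; pose s := s0 + 1.
have Mp : 0 < M by rewrite ltr_wpDl.
have sp : 0 < s by rewrite ltr_wpDl.
have TM : opbound T M by apply: opbound_le TM0; rewrite lerDl.
have Ss : opbound S s by apply: opbound_le Ss0; rewrite lerDl.
exists (M * s ^+ 2)^-1 => [|x]; first by rewrite invr_gt0 mulr_gt0 ?exprn_gt0.
rewrite ler_pdivrMl ?mulr_gt0 ?exprn_gt0 //.
have h : hnorm x ^+ 2 <= s ^+ 2 * hnorm (T x) ^+ 2.
  rewrite -exprMn ler_sqr ?nnegrE ?mulr_ge0 ?hnorm_ge0 ?(ltW sp) //.
  by rewrite -{1}[x]/(idfun x) -ST; exact: Ss.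
apply: le_trans h _; rewrite (mulrC M) -(mulrA (s ^+ 2) M) ler_wpM2l ?sqr_ge0 //.
exact: pos_sqr.
Qed.

(** * Generating the 2 by 2 matrices over the C*-algebra of D *)

Section Generators.
Variables (R : realType) (H : hilbertType R) (D : H -> H) (d : R).
Hypotheses (bD : bounded_op D) (pD1 : pos_op (D - idfun)) (d0 : 0 < d).
Hypothesis D1d : forall x, d * hnorm x ^+ 2 <= rdot ((D - idfun) x) x.

Local Notation l := (ell D).
Local Notation Qt := (op_block D (- l) l (idfun - D)).
Local Notation C := (Cstar_gen D).
Local Notation O := (0 : H -> H).

Let CC : Cstar_subalgebra C. Proof. exact: Cstar_gen_Cstar. Qed.
Let CD : C D. Proof. exact: Cstar_gen_mem. Qed.
Let bI : bounded_op (idfun : H -> H). Proof. exact: bounded_id. Qed.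
Let b0 : bounded_op (0 : H -> H). Proof. exact: bounded0. Qed.

Lemma pos_D : pos_op D.
Proof. by rewrite -(subrK idfun D); apply: pos_add pD1 (pos_id H). Qed.

Let aD : adj D D. Proof. exact: pos_adj pos_D. Qed.

Lemma pos_ell_sqr : pos_op (D \o (D - idfun)).
Proof.
have -> : D \o (D - idfun) = ((D - idfun) \o (D - idfun)) + (D - idfun).
  by apply/funext => x; rewrite !opE /= (opB _ _ bD); vec.
by apply: pos_add pD1; apply: pos_square; [exact: pos_bounded pD1 | exact: pos_adj pD1].
Qed.

Let pl : pos_op l. Proof. by case: (opsqrtP pos_ell_sqr). Qed.
Let bl : bounded_op l. Proof. exact: pos_bounded pl. Qed.
Let al : adj l l. Proof. exact: pos_adj pl. Qed.
Let ll x : l (l x) = D (D x - x).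
Proof.
by case: (opsqrtP pos_ell_sqr) => _ e _; rewrite -[LHS]/((opsqrt _ \o opsqrt _) x) e.
Qed.

Lemma ell_coercive x : d * hnorm x ^+ 2 <= rdot (l (l x)) x.
Proof.
have -> : l (l x) = (D - idfun) ((D - idfun) x) + (D - idfun) x.
  by rewrite ll !opE /= (opB _ _ bD); vec.
rewrite rdotDl (adj_rdot _ _ (pos_adj pD1)) -sqr_hnorm.
by apply: le_trans (D1d x) _; rewrite lerDr sqr_ge0.
Qed.

Lemma Cgen_id : C idfun.
Proof.
have h x : 1 * hnorm x ^+ 2 <= rdot (D x) x.
  have -> : D x = (D - idfun) x + x by rewrite !opE subrK.
  rewrite rdotDl mul1r -sqr_hnorm lerDr.
  by apply: le_trans (D1d x); rewrite mulr_ge0 ?sqr_ge0 // ltW.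
have [Y [_ hid _]] := coercive_inverse bD ltr01 h.
exact: (hid _ CC).
Qed.

Lemma Cgen_ell : C l.
Proof.
have [_ _ h] := opsqrtP pos_ell_sqr; apply: (h _ CC).
apply: (Cstar_comp CC) => //; apply: (Cstar_sub CC) => //; exact: Cgen_id.
Qed.

Lemma matrix2_Qt : matrix2 C Qt.
Proof.
exists D, (- l), l, (idfun - D); split => //; split => //.
- by rewrite opp_scale; apply: (Cstar_scale CC); exact: Cgen_ell.
- exact: Cgen_ell.
- by apply: (Cstar_sub CC) => //; exact: Cgen_id.
Qed.

Lemma adj_Qt : adj Qt (op_block D l (- l) (idfun - D)).
Proof.
apply: adj_block => //; first exact: adj_opp.
by apply: adj_add; [exact: adj_id | exact: adj_opp].
Qed.

Lemma bounded_Qt : bounded_op Qt.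
Proof. by apply: bounded_block => //; [exact: bounded_opp | exact: bounded_sub]. Qed.

Section InAlgebra.
Variable B : set (hsum H H -> hsum H H).
Hypotheses (CB : Cstar_subalgebra B).

Local Notation N := (op_block (0 : H -> H) (- (l + l)) (l + l) 0).

(** N is skew-adjoint, so <- N^2 x, x> = ||N x||^2, which is 4 times the sum of ||l x_1||^2 and ||l
    x_2||^2 and hence at least 4 d ||x||^2. *)
Lemma Cstar_id_of_skew : B N -> B idfun.
Proof.
move=> BN; have bll : bounded_op (l + l) by exact: bounded_add.
have bN : bounded_op N by apply: bounded_block => //; exact: bounded_opp.
have aN : adj N (- N).
  rewrite opp_block oppr0 opprK; apply: adj_block; try exact: adj0.
    exact/adj_opp/adj_add.
  exact: adj_add.
have h x : 4 * d * hnorm x ^+ 2 <= rdot ((- N \o N) x) x.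
  rewrite /= (adj_rdot _ _ (adj_sym aN)) -sqr_hnorm !sqr_hnorm_hsum /=.
  rewrite !opE add0r addr0 hnormN.
  have hl y : 4 * d * hnorm y ^+ 2 <= hnorm (l y + l y) ^+ 2.
    rewrite hnormD_sqr -sqr_hnorm.
    by have := ell_coercive y; rewrite (adj_rdot _ _ al) -sqr_hnorm; lra.
  by have := hl x.1; have := hl x.2; lra.
have d4 : 0 < 4 * d by rewrite mulr_gt0.
have [|Y [_ hid _]] := coercive_inverse _ d4 h; last first.
  apply: (hid _ CB); apply: (Cstar_comp CB) => //.
  by rewrite -scaleN1r; exact: (Cstar_scale CB).
by apply: bounded_comp => //; exact: bounded_opp.
Qed.

Hypotheses (Bid : B idfun) (BQt : B Qt).

Let B_adj_Qt : B (op_block D l (- l) (idfun - D)).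
Proof. by rewrite -(adj_adjoint adj_Qt); exact: Cstar_adjoint. Qed.

Lemma Cstar_corner_id : B (op_diag idfun 0).
Proof.
pose P := D + (D - idfun).
have pP : pos_op P by exact: pos_add pos_D pD1.
have [bP aP _] := pP.
have P1 x : hnorm x ^+ 2 <= rdot (P x) x.
  have -> : P x = (D - idfun) x + (D - idfun) x + x by rewrite /P !opE /=; vec.
  have [_ _ hD] := pD1.
  by rewrite rdotDl (rdotDl ((D - idfun) x)) -sqr_hnorm lerDr addr_ge0.
pose S := op_block P 0 0 (- P).
have BS : B S.
  have -> : S = Qt + op_block D l (- l) (idfun - D) - idfun.
    rewrite -diag_id op_diagE opp_block !add_block /S /P; congr op_block.
    - by rewrite addrA.
    - by rewrite addNr oppr0 addr0.
    - by rewrite subrr oppr0 addr0.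
    - by apply/funext => x; rewrite !opE /=; vec.
  apply: (Cstar_sub CB) => //; exact: (Cstar_add CB).
have aS : adj S S.
  by apply: adj_block => //; [exact: adj0 | exact: adj0 | exact: adj_opp].
have bS : bounded_op S by exact: (Cstar_bounded CB).
pose G := op_diag P P.
have bG : bounded_op G by exact: bounded_diag.
have aG : adj G G by exact: adj_diag.
have GG x : hnorm x ^+ 2 <= rdot (G x) x.
  by rewrite sqr_hnorm_hsum {1}/rdot cdot_hsum raddfD; exact: lerD (P1 _) (P1 _).
have BG : B G.
  have pG : pos_op G.
    by split => // x; apply: le_trans (GG x); exact: sqr_ge0.
  (* By uniqueness of positive roots [G] is the root of [S \o S], and that root stays in every
     C*-algebra containing [S \o S]. *)
  have SS : G \o G = S \o S.
    rewrite /G /S op_diagE !comp_block //; try exact: bounded_opp.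
    congr op_block; apply/funext => x; rewrite !opE /=.
    - by rewrite (op0 bP) oppr0.
    - by rewrite (opN _ bP) opprK.
  rewrite -(opsqrtE pG SS).
  have [_ _ h] := opsqrtP (pos_square bS aS); apply: (h _ CB).
  exact: (Cstar_comp CB).
have h x : 1 * hnorm x ^+ 2 <= rdot (G x) x by rewrite mul1r.
have [Y [[bY YG _] _ BY]] := coercive_inverse bG ltr01 h.
have -> : op_diag idfun 0 = (2^-1 : R[i]) *: (Y \o (S + G)).
  apply/funext => x; rewrite !opE.
  have -> : S x + G x = G (2 *: (x.1, 0) : hsum H H).
    rewrite /S /G /op_block /op_diag [LHS]surjective_pairing /= !opE.
    rewrite scaler0 (op0 bP) (opZ _ _ bP) add0r addr0 addNr.
    by rewrite scaler_nat mulr2n.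
  rewrite -[Y (G _)]/((Y \o G) _) YG /= scalerA mulVf ?pnatr_eq0 // scale1r.
  by [].
apply: (Cstar_scale CB); apply: (Cstar_comp CB); first exact: BY.
exact: (Cstar_add CB).
Qed.

(** Operators whose corner embedding lies in [B] form a C*-algebra, so only the generator [D] is
    checked, as the compression of Qt to the first summand. *)
Lemma Cstar_corner T : C T -> B (op_diag T 0).
Proof.
have sub : Cstar_subalgebra [set T : H -> H | bounded_op T /\ B (op_diag T 0)].
  by apply: (Cstar_pullback (phi := fun T => op_diag T 0)) CB; exact: star_hom_diagl.
move=> CT; suff BD : B (op_diag D 0) by case: (Cstar_gen_min sub (conj bD BD) CT).
have -> : op_diag D O = op_diag idfun 0 \o Qt \o op_diag idfun 0.
  apply/funext => x; rewrite /op_diag /op_block /= !opE /=.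
  by rewrite (op0 bl) oppr0 addr0.
have E := Cstar_corner_id.
by apply: (Cstar_comp CB) => //; exact: (Cstar_comp CB).
Qed.

Lemma Cstar_matrix2_sub T : matrix2 C T -> B T.
Proof.
have BE := Cstar_corner_id.
have ll' x : d * hnorm x ^+ 2 <= rdot ((l \o l) x) x by exact: ell_coercive.
(* The lower bound at hand is for the square of [l], so that square is inverted; [Z \o l] is then a
   left inverse of [l]. *)
have [Z [[bZ Zll _] _ CZ]] := coercive_inverse (bounded_comp bl bl) d0 ll'.
have B12 : B (op_block O idfun O O).
  have -> : op_block O idfun O O =
      (-1 : R[i]) *: (op_diag (Z \o l) O \o Qt \o (idfun - op_diag idfun O)).
    apply/funext => x; rewrite !opE /op_diag /op_block /= !opE /= subrr subr0.
    rewrite (op0 bD) !add0r (opN _ bl) (opN _ bZ) -[Z (l _)]/((Z \o (l \o l)) _) Zll.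
    by rewrite [RHS]surjective_pairing /= scaleN1r opprK scaler0.
  apply: (Cstar_scale CB); apply: (Cstar_comp CB); last exact: Cstar_sub.
  apply: (Cstar_comp CB) => //; apply: Cstar_corner; apply: (Cstar_comp CC).
    by apply: (CZ _ CC); apply: (Cstar_comp CC); exact: Cgen_ell.
  exact: Cgen_ell.
have B21 : B (op_block O O idfun O).
  rewrite -(_ : adjoint (op_block O idfun O O) = op_block O O idfun O).
    exact: (Cstar_adjoint CB).
  by apply: adj_adjoint; apply: adj_block; try exact: adj0; exact: adj_id.
move=> [a [b [c [e [[Ca Cb Cc Ce] ->]]]]].
have [ba bb bc be] : [/\ bounded_op a, bounded_op b, bounded_op c & bounded_op e].
  by split; exact: (Cstar_bounded CC).
have -> : op_block a b c e = op_diag a O + (op_diag b O \o op_block O idfun O O)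
    + (op_block O O idfun O \o op_diag c O)
    + (op_block O O idfun O \o op_diag e O \o op_block O idfun O O).
  apply/funext => x; rewrite !opE /op_diag /op_block [RHS]surjective_pairing /= !opE /=.
  by rewrite !addr0 !add0r.
have BT T : C T -> B (op_diag T 0) := @Cstar_corner T.
apply: (Cstar_add CB); last first.
  by apply: (Cstar_comp CB) => //; apply: (Cstar_comp CB) => //; exact: BT.
apply: (Cstar_add CB); last by apply: (Cstar_comp CB) => //; exact: BT.
apply: (Cstar_add CB); first exact: BT.
by apply: (Cstar_comp CB) => //; exact: BT.
Qed.

End InAlgebra.

End Generators.

Theorem theorem3p7 (R : realType) (H : hilbertType R) (Q : H -> H)
    (H1 H4 H5 H6 : closedSubspace H) (U : H5 -> H6) (D : H5 -> H5)
    (H_neq0 : exists x : H, x != 0)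
    (Q_idempotent : is_idempotent Q)
    (Q_nonproj : ~ is_projection Q)
    (QUD : canonical_decomposition Q H1 H4 U D)
    (D_spectrum : ~ spectrum D 1) :
  let V := canonical_unitary H1 H4 U in
  Cstar_gen Q =
  [set adjoint V \o op_diag (op_diag (alpha *: idfun) 0) T \o V
    | alpha in [set: R[i]] & T in matrix2 (Cstar_gen D)].
Proof.
move=> V; have [bQ Q2] := Q_idempotent.
have QQ x : Q (Q x) = Q x by rewrite -[LHS]/((Q \o Q) x) Q2.
have := canonical_unitaryP bQ QQ QUD; rewrite -/V; set V' := adjoint V.
set Qt := op_block _ _ _ _ => -[bV aV VV' V'V VQV'].
have bD := canonical_D QUD.
have /positive_opP pD1 := canonical_D_ge1 QUD.
have [d d0 D1d] : exists2 d : R, 0 < d &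
    forall x, d * hnorm x ^+ 2 <= rdot ((D - idfun) x) x.
  have [S iS] : exists S, is_op_inverse (D - idfun) S.
    by have := contrapT D_spectrum; rewrite scale1r.
  exact: pos_invertible_coercive pD1 iS.
have bV' : bounded_op V' := adj_bounded aV bV.
have aV' := adj_sym aV.
have QE : Q = V' \o op_diag (op_diag idfun 0) Qt \o V.
  rewrite -VQV'; have -> : V' \o (V \o Q \o V') \o V = (V' \o V) \o Q \o (V' \o V) by [].
  by rewrite V'V.
have CC := Cstar_gen_Cstar bD.
apply/seteqP; split => [S QS | _ [al _ [T MT <-]]].
  (* By minimality of the generated algebra, it suffices that the preimage of the block-diagonal
     algebra under conjugation by [V] is a C*-algebra containing [Q]. *)
  have Cdiag := Cstar_diag (Cstar_diag (@Cstar_scalars R H1) (@Cstar_zero_set R H4))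
    (Cstar_matrix2 CC).
  have [] := Cstar_gen_min (Cstar_pullback (star_hom_conj bV' aV' V'V VV') Cdiag) _ QS.
    split => //; exists (op_diag idfun 0), Qt; split.
    - by exists idfun, 0; split => //; exists 1; rewrite scale1r.
    - exact: matrix2_Qt pD1 d0 D1d.
    - exact: VQV'.
  move=> _ [_ [T [[_ [_ [[al ->] -> ->]]] MT E]]]; exists al => //; exists T => //.
  rewrite -E; have -> : V' \o (V \o S \o V') \o V = (V' \o V) \o S \o (V' \o V) by [].
  by rewrite V'V.
have CQ := Cstar_gen_Cstar bQ.
pose A1 := [set Y | bounded_op Y /\ Cstar_gen Q (V' \o Y \o V)].
have CA1 : Cstar_subalgebra A1.
  exact: Cstar_pullback (star_hom_conj bV aV VV' V'V) CQ.
have bQt : bounded_op Qt := bounded_Qt bD pD1.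
pose E1 : hsum H1 H4 -> hsum H1 H4 := op_diag idfun 0.
pose q := op_diag E1 Qt.
have bE1 : bounded_op E1.
  by apply: bounded_diag; [exact: bounded_id | exact: bounded0].
have A1q : A1 q.
  split; last by rewrite -QE; exact: Cstar_gen_mem.
  exact: bounded_diag.
pose B := [set Y : hsum H5 H5 -> hsum H5 H5 | bounded_op Y /\ A1 (op_diag 0 Y)].
have CB : Cstar_subalgebra B.
  by apply: (Cstar_pullback (phi := fun Y => op_diag 0 Y)) CA1; exact: star_hom_diagr.
have Bid : B idfun.
  apply: (Cstar_id_of_skew bD pD1 d0 D1d CB).
  set Qa := op_block D (ell D) (- ell D) (idfun - D).
  have aQt : adj Qt Qa := adj_Qt bD pD1.
  have -> : op_block 0 (- (ell D + ell D)) (ell D + ell D) 0 = Qt - Qa.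
    rewrite opp_block add_block opprK opprD; congr op_block; exact/esym/subrr.
  split; first by apply: bounded_sub => //; exact: adj_bounded bQt.
  have aE1 : adj E1 E1 by apply: adj_diag; [exact: adj_id | exact: adj0].
  (* The self-adjoint summand [E1] cancels, which places the difference in the second summand
     alone. *)
  have -> : op_diag 0 (Qt - Qa) = q - adjoint q.
    by rewrite (adj_adjoint (adj_diag aE1 aQt)) sub_diagl.
  by apply: (Cstar_sub CA1) => //; exact: (Cstar_adjoint CA1).
have BQt : B Qt.
  (* Multiplication by 0 + 1, available from [Bid], cuts [q] down to its second summand. *)
  by split => //; exact: (Cstar_comp CA1 Bid.2 A1q).
have A1E : A1 (op_diag E1 0).
  have -> : op_diag E1 0 = q - op_diag 0 Qt by rewrite /q [op_diag E1 Qt]diag_split addrK.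
  by apply: (Cstar_sub CA1) => //; exact: BQt.2.
have BT : B T := Cstar_matrix2_sub bD pD1 d0 D1d CB Bid BQt MT.
suff [] : A1 (op_diag (op_diag (al *: idfun) 0) T) by [].
have -> : op_diag (op_diag (al *: idfun) 0) T = al *: op_diag E1 0 + op_diag 0 T.
  rewrite diag_split -(starZ (@star_hom_diagl _ _ _)) //.
  by rewrite -(starZ (@star_hom_diagl _ _ _)) //; exact: bounded_id.
by apply: (Cstar_add CA1); [exact: (Cstar_scale CA1) | exact: BT.2].
Qed.
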